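(* Let $\theta\in(0,1)$ be irrational with $\theta^2=1/m$ for some $m\in\mathbb{N}_+$. For $\gamma_\theta$-almost every $x\in[0,\theta]$, \[ \lim_{n\to\infty}\frac{S_{n,\theta}(x)-L_{n,\theta}(x)}{n\log n}=\frac{1}{\log(1+\theta^2)}. \]
   Context: Let $m\in\mathbb{N}_+$ not be a perfect square and $\theta=1/\sqrt m\in(0,1)$ (so $\theta$ is irrational and $\theta^2=1/m$). The map $T_\theta:[0,\theta]\to[0,\theta]$ is $T_\theta(x)=\frac1x-\theta\lfloor\frac{1}{\theta x}\rfloor$ for $x\in(0,\theta]$ and $T_\theta(0)=0$. The digits of $x$ are $\ell_n(x)=\lfloor \frac{1}{\theta T_\theta^{n-1}(x)}\rfloor$ for $n\ge1$ (with $T_\theta^0(x)=x$); they take values in $\{m,m+1,\dots\}$ and are defined for almost every $x$. The probability measure $\gamma_\theta$ on $[0,\theta]$ has density $\frac{1}{\log(1+\theta^2)}\cdot\frac{\theta}{1+\theta x}$ with respect to Lebesgue measure; it is $T_\theta$-invariant and ergodic. Define $S_{n,\theta}(x)=\sum_{k=1}^n\ell_k(x)$ and $L_{n,\theta}(x)=\max_{1\le k\le n}\ell_k(x)$. *)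

(* Defs.v *)
From HB Require Import structures.
From mathcomp Require Import all_boot all_order all_algebra.
From mathcomp Require Import all_classical all_reals all_analysis.
Set Implicit Arguments. Unset Strict Implicit. Unset Printing Implicit Defensive.
Import Order.TTheory GRing.Theory Num.Theory.
Local Open Scope ring_scope.
Local Open Scope classical_set_scope.

Definition theta {R : realType} (m : nat) : R := (Num.sqrt (m%:R : R))^-1.

Definition Ttheta {R : realType} (m : nat) (x : R) : R :=
  if x == 0 then 0
  else x^-1 - theta m * (Num.floor ((theta m * x)^-1))%:~R.

(* digit k x = l_{k+1}(x) = floor(1 / (theta * T_theta^k x)) (0-indexed) *)
Definition digit {R : realType} (m : nat) (k : nat) (x : R) : R :=
  (Num.floor ((theta m * iter k (Ttheta m) x)^-1))%:~R.

Definition Ssum {R : realType} (m n : nat) (x : R) : R :=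
  \sum_(k < n) digit m k x.

(* L_{n,theta}(x) = max_{1<=k<=n} l_k(x)  (digits are >= m >= 1 > 0) *)
Definition Lmax {R : realType} (m n : nat) (x : R) : R :=
  \big[Num.max/0]_(k < n) digit m k x.

Definition gamma_density {R : realType} (m : nat) (x : R) : R :=
  (ln (1 + theta m ^+ 2))^-1 * (theta m / (1 + theta m * x)).

Definition gamma_theta {R : realType} (m : nat) (A : set R) : \bar R :=
  (\int[@lebesgue_measure R]_(x in A `&` [set y : R | (0 <= y <= theta m)%R]) (gamma_density m x)%:E)%E.

(* Main.v *)
(** Under the invariant density, T has full branches x = 1 / (theta l + y), l >= m,
    and its transfer operator maps a nondecreasing function to a nonincreasing one
    whose oscillation is at most 1/2 of the original; hence monotone functions of x
    decorrelate exponentially from the future. The indicator of {digit >= t} is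
    monotone and has explicit image, of oscillation at most 1/t, which is O(1/t)
    like its mean. Summing over t <= M, the truncated digits min(digit, M) have
    mean log M / log (1 + theta^2) + O(1) and partial sums of variance O(n M),
    and two of the first n digits exceed M with probability O(n^2 / M^2).
    Along blocks n_j with n_(j+1) / n_j -> 1, and with M_j a power of log n_j times
    n_j, the Chebyshev and pair bounds are summable. So almost surely, eventually
    at most one of the first n_(j+1) digits exceeds M_j; it is the maximum, and
    the sum without it lies within M_j = o(n_j log n_j) of the truncated sum,
    which is asymptotic to its mean. Monotonicity in n interpolates between
    blocks. *)
Require Import Defs.
From HB Require Import structures.
From mathcomp Require Import all_boot all_order all_algebra.
From mathcomp Require Import all_classical all_reals all_analysis.
From mathcomp Require Import measurable_realfun ring lra.
Import Order.TTheory GRing.Theory Num.Theory.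
Import numFieldNormedType.Exports.
Local Open Scope ring_scope.
Local Open Scope classical_set_scope.

Set Implicit Arguments.
Unset Strict Implicit.
Unset Printing Implicit Defensive.

(** A digit is at least t with probability about c / t, where c is the limit constant. It has
    infinite mean, the ergodic theorem only gives S_n / n -> oo, and the proof is a second-moment
    argument with a tight budget. As a single monotone function of oscillation M, min(digit, M)
    would have covariances bounded by M log M; the variance over a block, divided by (n_j log
    n_j)^2, would then be bounded by M_j / (n_j log n_j), of order [s_j^-2], not summable because
    [s_j^7 = j + 1]. With indicators, of oscillation 1/t after one step, the total oscillation and
    the mean are both O(log M), so the covariances are O((log M)^2), absorbed in M. Likewise, an
    error 1/t times a mean O(1/t) makes a pair of large digits as rare, up to a constant, as under
    independence. The contraction factor 1/2 bounds the weight 1/(m+1) of the first branch at 0. The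
    exponents 6 for log n_j and 4 for M_j / n_j, in powers of [s_j], meet all demands: 6 < 7 gives
    n_(j+1) / n_j -> 1, 4 < 6 gives M_j = o(n_j log n_j), and 2 * 6 - 4 and 2 * 4 both equal 8 > 7,
    the summability of the two moment bounds. *)

Section weighted_pushforward.
Context d1 d2 (X : measurableType d1) (Y : measurableType d2) (R : realType).
Variables (mu : {measure set X -> \bar R}) (D : set X) (v : X -> Y) (w : X -> R).
Hypotheses (mD : measurable D) (mv : measurable_fun [set: X] v).
Hypotheses (mw : measurable_fun [set: X] w) (w0 : forall x, 0 <= w x).
Local Open Scope ereal_scope.

(** Image under [v] of the measure with density [w] on [D]. When [v] is injective and [w] is the
    absolute value of its derivative, this is Lebesgue measure on the image of [D], so substitution
    becomes an equality of measures. *)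
Definition wpush (B : set Y) : \bar R :=
  \int[mu]_(x in D `&` v @^-1` B) (w x)%:E.

Let mvB B : measurable B -> measurable (D `&` v @^-1` B).
Proof. by move=> mB; apply: measurableI => //; rewrite -[_ @^-1` _]setTI; exact: mv. Qed.

Let wpush0 : wpush set0 = 0.
Proof. by rewrite /wpush preimage_set0 setI0 integral_set0. Qed.

Let wpush_ge0 B : 0 <= wpush B.
Proof. by apply: integral_ge0 => x _; rewrite lee_fin. Qed.

Let wpush_sigma_additive : semi_sigma_additive wpush.
Proof.
move=> /= A mA tA mUA.
rewrite /wpush preimage_bigcup setI_bigcupr ge0_integral_bigcup//; first last.
- move=> i j _ _ [x [[Dx Ai] [_ Aj]]].
  by apply: tA => //; exists (v x).
- by move=> x _; rewrite lee_fin.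
- by apply/measurable_EFinP; exact: measurable_funS mw.
- by move=> k; exact: mvB.
by apply: is_cvg_ereal_nneg_natsum_cond => n _ _; exact: wpush_ge0.
Qed.

HB.instance Definition _ := isMeasure.Build _ _ _
  wpush wpush0 wpush_ge0 wpush_sigma_additive.

Definition wpush_measure : {measure set Y -> \bar R} := wpush.

Import HBNNSimple.

(** Monotone convergence reduces to simple functions, additivity to one indicator, and there both
    sides are the definition of [wpush]. *)
Lemma ge0_integral_wpush (f : Y -> \bar R) :
  measurable_fun [set: Y] f -> (forall y, 0 <= f y) ->
  \int[wpush]_y f y = \int[mu]_(x in D) (f (v x) * (w x)%:E).
Proof.
move=> mf f0.
pose h := nnsfun_approx measurableT mf.
have mfv n : measurable_fun D (fun x => ((h n) (v x))%:E).
  apply/measurable_EFinP/measurable_funTS.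
  by apply: measurableT_comp mv; exact/measurable_funP.
have mwE : measurable_fun D (fun x => (w x)%:E).
  by apply/measurable_EFinP; exact: measurable_funS mw.
transitivity (limn (fun n => \int[wpush]_y (h n y)%:E)).
  rewrite -monotone_convergence//.
  - apply: eq_integral => y _; apply/esym/cvg_lim => //.
    exact: cvg_nnsfun_approx.
  - by move=> n; exact/measurable_EFinP/measurable_funP.
  - by move=> n y _; rewrite lee_fin.
  - by move=> y _ a b ab; rewrite lee_fin; exact/lefP/nd_nnsfun_approx.
transitivity (limn (fun n => \int[mu]_(x in D) ((h n (v x))%:E * (w x)%:E))); last first.
  rewrite -monotone_convergence//.
  - apply: eq_integral => x _; apply/cvg_lim => //.
    by apply: cvgeZr => //; exact: cvg_nnsfun_approx.
  - by move=> n; exact: emeasurable_funM.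
  - by move=> n x _; rewrite mule_ge0 ?lee_fin.
  - move=> x _ a b ab; rewrite lee_wpmul2r ?lee_fin//.
    exact/lefP/nd_nnsfun_approx.
congr (limn _); apply/funext => n.
transitivity (\int[wpush]_y
   (\sum_(r \in range (h n)) (r * \1_(h n @^-1` [set r]) y)%:E)).
  by apply: eq_integral => t _; rewrite fimfunE -fsumEFin.
rewrite ge0_integral_fsum//; last 2 first.
- by move=> r; exact/measurable_EFinP/measurable_funM.
- by move=> r y _; exact: nnfun_muleindic_ge0.
transitivity (\int[mu]_(x in D) (\sum_(r \in range (h n))
    (r * \1_(h n @^-1` [set r]) (v x))%:E * (w x)%:E)); last first.
  apply: eq_integral => x xD; rewrite -ge0_mule_fsuml => [|r].
    by rewrite fsumEFin // -(fimfunE _ (v x)).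
  exact: nnfun_muleindic_ge0.
have m1 r : measurable_fun D (fun x => (\1_(h n @^-1` [set r]) (v x))%:E : \bar R).
  apply/measurable_EFinP/measurable_funTS.
  by apply: measurableT_comp mv; exact: measurable_indic.
rewrite ge0_integral_fsum//; last 2 first.
- move=> r; apply: emeasurable_funM => //.
  by under eq_fun do rewrite EFinM; apply: measurable_funeM.
- by move=> r x _; rewrite mule_ge0 ?lee_fin//; exact: nnfun_muleindic_ge0.
apply: eq_fsbigr => r rhn.
rewrite integralZl_indic_nnsfun//.
under [RHS]eq_integral do rewrite EFinM -muleA.
rewrite [RHS]ge0_integralZl//; first last.
- by move: rhn; rewrite inE => -[t _ <-]; rewrite lee_fin.
- by move=> x _; rewrite mule_ge0 ?lee_fin.
- exact: emeasurable_funM.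
congr (_ * _).
rewrite integral_indic// setIT /= /wpush integral_mkcondr.
apply: eq_integral => x _; rewrite /patch indicE.
have -> : (x \in v @^-1` (h n @^-1` [set r])) = (v x \in h n @^-1` [set r]).
  by apply/idP/idP; rewrite !inE.
by case: ifP => _; rewrite ?mul1e ?mul0e.
Qed.

End weighted_pushforward.

(** * Substitution on the real line for measurable integrands *)

Section change_of_variable.
Context {R : realType}.
Notation mu := (@lebesgue_measure R).
Local Open Scope ereal_scope.

(** Both integrals are taken against a [wpush] measure ([M1] uses the identity and weight 1).
    Half-open intervals generate the Borel sets and are stable under intersection, so agreement on
    them, with finite mass on an exhaustion, identifies the measures. *)
Lemma integral_wpush_itv (C D : set R) (v w : R -> R) (f : R -> \bar R) :
  measurable C -> measurable D -> mu C < +oo ->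
  measurable_fun [set: R] v -> measurable_fun [set: R] w ->
  (forall x, (0 <= w x)%R) ->
  (forall a b : R, mu (C `&` `]a, b]) = wpush mu D v w `]a, b]) ->
  measurable_fun [set: R] f -> (forall x, 0 <= f x) ->
  \int[mu]_(x in C) f x = \int[mu]_(x in D) (f (v x) * (w x)%:E).
Proof.
move=> mC mD Coo mv mw w0 CD mf f0.
have mid : measurable_fun [set: R] (@idfun R) by exact: measurable_id.
have m1cst : measurable_fun [set: R] (cst 1%R : R -> R) by exact: measurable_cst.
have cst1 : forall x : R, (0 <= cst 1%R x :> R)%R by move=> x; exact: ler01.
pose M1 := wpush_measure mu mC mid m1cst cst1.
pose M2 := wpush_measure mu mD mv mw w0.
have M1E A : measurable A -> M1 A = mu (C `&` A).
  move=> mA; have mCA : measurable (C `&` A) by exact: measurableI.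
  by rewrite /M1/= /wpush preimage_id (integral_cst mu mCA 1) mul1e.
transitivity (\int[M1]_x f x).
  have := ge0_integral_wpush mu mC mid m1cst cst1 mf f0.
  move=> /= ->.
  by apply: eq_integral => x _; rewrite mule1.
transitivity (\int[M2]_x f x); last exact: (ge0_integral_wpush mu mD mv mw w0 mf f0).
apply: eq_measure_integral => A mA _.
pose g (k : nat) : set R := `](- k%:R)%R, k%:R%R]%classic.
apply: (@measure_unique _ R R (@ocitv R) g _ _ _ _ M1 M2) => //.
- by move=> X Y; exact: ocitvI.
- by move=> i; exact: is_ocitv.
- rewrite -subTset => x _.
  pose n := (Num.truncn `|x|).+1.
  exists n => //; rewrite /g /= in_itv/=.
  have : (`|x| < n%:R)%R by rewrite truncnS_gt.
  by rewrite ltr_norml => /andP[-> /ltW ->].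
- move=> _ [[a b] _ <-]; rewrite M1E; first exact: CD.
  by apply: sub_sigma_algebra; exact: is_ocitv.
- move=> k; have mg : measurable (g k) by exact: measurable_itv.
  change (M1 (g k) < +oo); rewrite (M1E _ mg).
  by apply: le_lt_trans Coo; apply: le_measure; rewrite ?inE//; exact: measurableI.
Qed.

End change_of_variable.

(** * Measurability of the inverse and the fundamental theorem of calculus *)

Section calculus.
Context {R : realType}.
Notation mu := (@lebesgue_measure R).

Lemma measurable_inv : measurable_fun [set: R] (@GRing.inv R).
Proof.
(* The inverse is not continuous at 0; this product of measurable functions also takes the value 0
   there. *)
have -> : @GRing.inv R = (fun x => x * (x ^+ 2) `^ (- 1)).
  apply/funext => x; have [->|x0] := eqVneq x 0; first by rewrite invr0 mul0r.
  rewrite powR_inv1 ?sqr_ge0// expr2 invfM mulrA divff// mul1r//.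
apply: measurable_funM; first exact: measurable_id.
apply: (measurableT_comp (measurable_powR (- 1))).
exact: measurable_funX.
Qed.

Lemma FTC2_is_derive (f F : R -> R) (c d : R) : c < d ->
  {in `[c, d]%R, forall x : R, is_derive x 1 F (f x)} ->
  {in `[c, d]%R, forall x : R, {for x, continuous f}} ->
  (\int[mu]_(x in `[c, d]) (f x)%:E = (F d)%:E - (F c)%:E)%E.
Proof.
move=> cd dF cf.
have cF x : x \in `[c, d]%R -> F z @[z --> x] --> F x.
  by move=> /dF[dFx _]; exact/differentiable_continuous/derivable1_diffP.
apply: continuous_FTC2 => //.
- by apply: continuous_in_subspaceT => x /set_mem xcd; exact: (cf x xcd).
- split.
  + by move=> x /subset_itv_oo_cc xcd; case: (dF x xcd).
  + by apply/cvg_at_right_filter/cF; rewrite bound_itvE; exact: ltW.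
  + by apply/cvg_at_left_filter/cF; rewrite bound_itvE; exact: ltW.
- by move=> x /subset_itv_oo_cc xcd; rewrite derive1E; case: (dF x xcd).
Qed.

End calculus.

(** * Inverse branches of the map *)

Section branches.
Context {R : realType} (m : nat) (hm : (0 < m)%N).
Notation mu := (@lebesgue_measure R).
Local Notation th := (theta m : R).

Lemma theta_gt0 : 0 < th.
Proof. by rewrite /theta invr_gt0 sqrtr_gt0 ltr0n. Qed.

Lemma theta_sqrM : th * th * m%:R = 1.
Proof.
rewrite /theta -invfM -expr2 sqr_sqrtr// mulVf// pnatr_eq0.
by rewrite -lt0n.
Qed.

Definition branch (l : nat) (y : R) : R := (th * l%:R + y)^-1.

(** Absolute value of the derivative of [branch l]: the branch decreases, and a weight has to be
    nonnegative. *)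
Definition dbranch (l : nat) (y : R) : R := ((th * l%:R + y) ^+ 2)^-1.

Lemma measurable_branch l : measurable_fun [set: R] (branch l).
Proof.
apply: (measurableT_comp measurable_inv).
by apply: measurable_funD => //; exact: measurable_cst.
Qed.

Lemma measurable_dbranch l : measurable_fun [set: R] (dbranch l).
Proof.
apply: (measurableT_comp measurable_inv).
apply: measurable_funX.
by apply: measurable_funD => //; exact: measurable_cst.
Qed.

Lemma dbranch_ge0 l y : 0 <= dbranch l y.
Proof. by rewrite invr_ge0 sqr_ge0. Qed.

Lemma theta_nat_gt0 l y : (0 < l)%N -> 0 <= y -> 0 < th * l%:R + y.
Proof.
move=> l0 y0; apply: ltr_wpDr => //.
by rewrite mulr_gt0 ?theta_gt0// ltr0n.
Qed.

Lemma integral_dbranch l c d : (0 < l)%N -> 0 <= c -> c < d ->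
  (\int[mu]_(y in `[c, d[) (dbranch l y)%:E = (branch l c - branch l d)%:E)%E.
Proof.
move=> l0 c0 cd; rewrite integral_itv_bndo_bndc; last first.
  by apply/measurable_EFinP; apply: measurable_funTS; exact: measurable_dbranch.
have pos x : x \in `[c, d]%R -> th * l%:R + x != 0.
  rewrite in_itv/= => /andP[cx _]; apply: lt0r_neq0.
  by apply: theta_nat_gt0 => //; exact: le_trans cx.
rewrite (@FTC2_is_derive _ _ (fun y => - branch l y))//.
- by rewrite -EFinB opprK addrC.
- move=> x xcd.
  have -> : dbranch l x = - (- (th * l%:R + x) ^- 2 *: (0 + 1)).
    by rewrite /dbranch add0r scaleNr opprK /GRing.scale/= mulr1.
  apply: is_deriveN.
  by apply: (@is_deriveV _ (fun y => th * l%:R + y)); first exact: pos.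
- move=> x xcd; apply: continuousV; first by rewrite expf_neq0// pos.
  apply: (@continuous_comp _ _ _ (fun y => th * l%:R + y) (fun z => z ^+ 2)).
    by apply: cvgD; [exact: cvg_cst|exact: cvg_id].
  exact: exprn_continuous.
Qed.

Lemma branch_lt l x y : (0 < l)%N -> 0 <= x -> 0 <= y ->
  (branch l x < branch l y) = (y < x).
Proof.
move=> l0 x0 y0; rewrite ltf_pV2 ?posrE ?theta_nat_gt0//.
by rewrite ltrD2l.
Qed.

Lemma branch_theta l : branch l th = branch l.+1 0.
Proof. by rewrite /branch addr0 -natr1 mulrDr mulr1. Qed.

(** The branch decreases, so a piece []a', b']] of its image pulls back to [[c, d[] with the ends
    exchanged, and integrating [dbranch] over it returns [b' - a']. This is the interval test
    required by [integral_wpush_itv]. *)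
Lemma branch_itv_wpush l (a b : R) : (0 < l)%N ->
  mu (`]branch l th, branch l 0] `&` `]a, b]) =
  wpush mu `[0, th[ (branch l) (dbranch l) `]a, b].
Proof.
move=> l0; rewrite /wpush.
pose a' := Num.max a (branch l th); pose b' := Num.min b (branch l 0).
have vth : 0 < branch l th.
  by rewrite invr_gt0 theta_nat_gt0// ltW// theta_gt0.
have v0 : branch l 0 = (th * l%:R)^-1 by rewrite /branch addr0.
have -> : `]branch l th, branch l 0] `&` `]a, b] = `]a', b']%classic.
  apply/seteqP; split => x /=; rewrite !in_itv/= gt_max le_min.
    by move=> [/andP[-> ->] /andP[-> ->]].
  by move=> /andP[/andP[-> ->] /andP[-> ->]].
have pre y : 0 <= y -> (y \in `[0, th[%R) && (branch l y \in `]a, b]%R) =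
    (a' < branch l y <= b').
  move=> y0; rewrite !in_itv/= y0/= gt_max le_min branch_lt//; last first.
    exact/ltW/theta_gt0.
  have -> : branch l y <= branch l 0 by rewrite leNgt branch_lt// -leNgt.
  by rewrite andbT andbAC andbC -andbA; case: (a < _); case: (y < th); case: (_ <= b).
have [ab|ab] := leP b' a'.
  rewrite set_itv_ge ?bnd_simp -?leNgt// measure0.
  rewrite [X in (\int[_]_(x in X) _)%E](_ : _ = set0) ?integral_set0//.
  apply/seteqP; split => // y [yD yab].
  have y0 : 0 <= y by move: yD; rewrite /= in_itv/= => /andP[].
  have := pre y y0; rewrite yD yab => /esym/andP[h1 h2].
  by have := lt_le_trans h1 h2; rewrite ltNge ab.
have a'0 : 0 < a' by rewrite lt_max vth orbT.
have b'0 : 0 < b' by exact: lt_trans ab.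
pose c := b'^-1 - th * l%:R; pose d := a'^-1 - th * l%:R.
have c0 : 0 <= c.
  rewrite subr_ge0 -[leLHS]invrK lef_pV2 ?posrE ?invr_gt0 ?mulr_gt0 ?theta_gt0 ?ltr0n//.
  by rewrite -v0 ge_min lexx orbT.
have cd : c < d by rewrite ltrD2r ltf_pV2.
have vc : branch l c = b' by rewrite /branch addrC subrK invrK.
have vd : branch l d = a' by rewrite /branch addrC subrK invrK.
rewrite [X in (\int[_]_(x in X) _)%E](_ : _ = `[c, d[%classic); last first.
  apply/seteqP; split => y /=.
    move=> [yD yab]; have y0 : 0 <= y by move: yD; rewrite in_itv/= => /andP[].
    have := pre y y0; rewrite yD yab => /esym.
    rewrite -vc -vd branch_lt ?(le_trans c0 (ltW cd))//.
    by rewrite leNgt branch_lt// -leNgt in_itv/= andbC.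
  move=> ycd; have y0 : 0 <= y.
    by move: ycd; rewrite in_itv/= => /andP[cy _]; exact: le_trans cy.
  have := pre y y0.
  rewrite -vc -vd branch_lt ?(le_trans c0 (ltW cd))//.
  rewrite [_ <= branch l c]leNgt branch_lt// -leNgt andbC.
  by move: ycd; rewrite in_itv/= andbC => -> /andP[].
by rewrite integral_dbranch// vc vd lebesgue_measure_itv/= lte_fin ab.
Qed.

End branches.

(** * Transfer operator with respect to the invariant density *)

Section transfer.
Context {R : realType} (m : nat) (hm : (0 < m)%N).
Notation mu := (@lebesgue_measure R).
Local Notation th := (theta m : R).
Local Notation T := (Ttheta m : R -> R).
Local Notation h := (gamma_density m : R -> R).

Lemma mem_branch l (x : R) : (0 < l)%N -> 0 < x ->
  (branch m l th < x <= branch m l 0) = (l%:R <= (th * x)^-1 < l.+1%:R).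
Proof.
move=> l0 x0; have th0 : 0 < th := theta_gt0 hm.
rewrite branch_theta /branch !addr0 [(th * x)^-1]invfM.
rewrite andbC invf_plt ?posrE ?mulr_gt0 ?ltr0n// invf_pge ?posrE ?mulr_gt0 ?ltr0n//.
by rewrite ltr_pdivrMl// ler_pdivlMl.
Qed.

(** From theta^2 m = 1: the branch of digit [m] ends exactly at [th], so the branches with l >= m
    tile []0, th]] and all of them are full. *)
Lemma branch_m0 : branch m m 0 = th.
Proof.
by rewrite /branch addr0; apply: mulr1_eq; rewrite mulrC mulrA theta_sqrM.
Qed.

Lemma branch_bounds l y : (m <= l)%N -> 0 <= y -> 0 < branch m l y <= th.
Proof.
move=> ml y0; have l0 : (0 < l)%N by exact: leq_trans ml.
rewrite invr_gt0 theta_nat_gt0//= -branch_m0.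
rewrite lef_pV2 ?posrE ?theta_nat_gt0// addr0.
rewrite -[leLHS]addr0 lerD// ler_pM2l ?ler_nat//.
exact: theta_gt0.
Qed.

(** The cylinders [C k] of first digit [k + m] partition []0, th]]. Substitution applies on each of
    them, and nonnegativity allows sum and integral to be exchanged. *)
Lemma ge0_integral_branches (f : R -> \bar R) :
  measurable_fun [set: R] f -> (forall x, 0 <= f x)%E ->
  (\int[mu]_(x in `]0%R, th[) f x =
   \int[mu]_(y in `]0%R, th[) \sum_(0 <= k <oo) (f (branch m (k + m) y) * (dbranch m (k + m) y)%:E))%E.
Proof.
move=> mf f0; have th0 : 0 < th := theta_gt0 hm.
have lm0 k : (0 < k + m)%N by rewrite addn_gt0 hm orbT.
rewrite integral_itv_bndo_bndc; last exact: measurable_funS mf.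
pose C k : set R := `]branch m (k + m) th, branch m (k + m) 0]%classic.
have -> : `]0, th]%classic = \bigcup_k C k.
  apply/seteqP; split => x.
    rewrite /= in_itv/= => /andP[x0 xth].
    have tx : 0 < (th * x)^-1 by rewrite invr_gt0 mulr_gt0.
    have := truncn_itv (ltW tx); set l := Num.trunc _ => /andP[l1 l2].
    have ml : (m <= l)%N.
      rewrite -ltnS -(ltr_nat R); apply: le_lt_trans l2.
      rewrite -[leLHS]invrK lef_pV2 ?posrE ?invr_gt0 ?ltr0n ?mulr_gt0//.
      rewrite -(ler_pM2r (_ : 0 < m%:R)) ?ltr0n// mulVf ?pnatr_eq0 -?lt0n//.
      by rewrite -[leRHS](theta_sqrM hm) ler_wpM2r// ler_wpM2l// ltW.
    exists (l - m)%N => //; rewrite /C /= in_itv/= subnK//.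
    by rewrite mem_branch ?l1 ?l2//; exact: leq_trans ml.
  move=> [k _]; rewrite /C /= !in_itv/= => /andP[h1 h2].
  have /andP[b1 _] := branch_bounds (leq_addl k m) (ltW th0).
  have /andP[_ b2] := branch_bounds (leq_addl k m) (lexx 0).
  by rewrite (lt_trans b1 h1) (le_trans h2 b2).
rewrite ge0_integral_bigcup//; last 3 first.
- by move=> k; exact: measurable_itv.
- exact: measurable_funS mf.
- move=> i j _ _ [x []]; rewrite /C /= !in_itv/= => xi xj.
  have x0 : 0 < x.
    have /andP[b1 _] := branch_bounds (leq_addl i m) (ltW th0).
    by case/andP: xi => + _; exact: lt_trans.
  move: xi xj; rewrite !mem_branch// => /andP[i1 i2] /andP[j1 j2].
  have := le_lt_trans i1 j2; have := le_lt_trans j1 i2.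
  rewrite !ltr_nat !ltnS !leq_add2r => ji ij.
  by apply/eqP; rewrite eqn_leq ij ji.
have mterm k : measurable_fun [set: R]
    (fun y => f (branch m (k + m) y) * (dbranch m (k + m) y)%:E)%E.
  apply: emeasurable_funM.
    by apply: measurableT_comp mf _; exact: measurable_branch.
  by apply/measurable_EFinP; exact: measurable_dbranch.
rewrite [RHS](@integral_nneseries _ _ _ mu _ _ (fun k y =>
    f (branch m (k + m) y) * (dbranch m (k + m) y)%:E)%E)//; last 2 first.
- by move=> k; apply: measurable_funTS; exact: mterm.
- by move=> k y _; rewrite mule_ge0// lee_fin dbranch_ge0.
apply: eq_eseriesr => k _.
rewrite [RHS]integral_itv_obnd_cbnd; last exact: measurable_funS (mterm k).
apply: integral_wpush_itv => //.
- exact: measurable_itv.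
- by rewrite /C lebesgue_measure_itv/=; case: ifPn => // _; rewrite -EFinB ltry.
- exact: measurable_branch.
- exact: measurable_dbranch.
- exact: dbranch_ge0.
- by move=> a b; exact: branch_itv_wpush.
Qed.

(** The convention 0^-1 = 0 makes the formula agree with the separate value at 0. *)
Lemma TthetaE (x : R) : T x = x^-1 - th * (Num.floor (th * x)^-1)%:~R.
Proof.
rewrite /Ttheta; case: eqP => [->|//].
by rewrite mulr0 invr0 floor0 mulr0 subr0.
Qed.

Lemma measurable_floor : measurable_fun [set: R] (fun x : R => (Num.floor x)%:~R : R).
Proof.
by apply: nondecreasing_measurable => // x y xy; rewrite ler_int le_floor.
Qed.

Lemma measurable_digit0 : measurable_fun [set: R] (@digit R m 0).
Proof.
apply: (measurableT_comp measurable_floor).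
apply: (measurableT_comp measurable_inv).
by apply: measurable_funM; [exact: measurable_cst|exact: measurable_id].
Qed.

Lemma measurable_Ttheta : measurable_fun [set: R] T.
Proof.
rewrite (_ : T = fun x => x^-1 - th * digit m 0 x); last first.
  by apply/funext => x; rewrite TthetaE.
apply: measurable_funB; first exact: measurable_inv.
by apply: measurable_funM; [exact: measurable_cst|exact: measurable_digit0].
Qed.

Lemma measurable_iter_Ttheta k : measurable_fun [set: R] (iter k T).
Proof.
elim: k => [|k ih]; first exact: measurable_id.
exact: (measurableT_comp measurable_Ttheta ih).
Qed.

Lemma digit_branch l y : (0 < l)%N -> 0 <= y < th -> digit m 0 (branch m l y) = l%:R.
Proof.
move=> l0 /andP[y0 yth]; have th0 : 0 < th := theta_gt0 hm.
have a0 : 0 < th * l%:R + y by exact: theta_nat_gt0.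
have e : (th * branch m l y)^-1 = l%:R + th^-1 * y.
  by rewrite /branch; field; rewrite !lt0r_neq0.
rewrite /digit/= e (@floor_def _ _ l%:Z)//.
rewrite intrD -!pmulrn lerDl mulr_ge0 ?invr_ge0 ?(ltW th0)//=.
by rewrite ltrD2l ltr_pdivrMl// mulr1.
Qed.

Lemma Ttheta_branch l y : (0 < l)%N -> 0 <= y < th -> T (branch m l y) = y.
Proof.
move=> l0 yth; rewrite TthetaE -[_%:~R]/(digit m 0 (branch m l y)).
by rewrite digit_branch// invrK addrC addrA addNr add0r.
Qed.

(** Conditional probability, under the invariant measure, that the first digit of x is [l] given T x
    = y; [density_branch] is the Bayes identity behind it. *)
Definition branch_prob (l : nat) (y : R) : R :=
  (1 + th * y) / ((th * l%:R + y) * (th * l.+1%:R + y)).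

Lemma density_branch l y : (0 < l)%N -> 0 <= y ->
  h (branch m l y) * dbranch m l y = branch_prob l y * h y.
Proof.
move=> l0 y0; have th0 : 0 < th := theta_gt0 hm.
rewrite /gamma_density /branch_prob /dbranch /branch.
set a := th * l%:R + y.
have a0 : 0 < a by exact: theta_nat_gt0.
have -> : th * l.+1%:R + y = a + th by rewrite /a -natr1 mulrDr mulr1 addrAC.
have y1 : 0 < 1 + th * y by rewrite ltr_pwDl// mulr_ge0// ltW.
have -> : 1 + th / a = (a + th) / a by field; rewrite lt0r_neq0.
field; rewrite !lt0r_neq0//.
- by rewrite addr_gt0.
- by rewrite ln_gt0// ltrDl exprn_gt0.
Qed.

Lemma density_gt0 y : 0 <= y -> 0 < h y.
Proof.
move=> y0; have th0 : 0 < th := theta_gt0 hm.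
rewrite mulr_gt0 ?invr_gt0 ?divr_gt0//.
  by rewrite ln_gt0// ltrDl exprn_gt0.
by rewrite ltr_pwDl// mulr_ge0// ltW.
Qed.

Lemma measurable_density : measurable_fun [set: R] h.
Proof.
apply: measurable_funM; first exact: measurable_cst.
apply: measurable_funM; first exact: measurable_cst.
apply: (measurableT_comp measurable_inv).
apply: measurable_funD; first exact: measurable_cst.
by apply: measurable_funM; [exact: measurable_cst|exact: measurable_id].
Qed.

(** Leaving out the null points 0 and [th] means that integrands need control only for 0 < x <
    th. *)
Definition expect (F : R -> R) : R := \int[mu]_(x in `]0, th[) (F x * h x).

Local Notation Ex := expect.

(** Duality between composition with [T] and the transfer operator. The image [F'] enters as a
    pointwise limit, so closed forms such as 1 or [branch_tail] can be supplied directly. *)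
Lemma Ex_transfer (F G F' : R -> R) :
  measurable_fun [set: R] F -> measurable_fun [set: R] G ->
  (forall x, 0 <= F x) -> (forall x, 0 <= G x) ->
  (forall y, 0 < y < th ->
    series (fun k => branch_prob (k + m) y * F (branch m (k + m) y)) @ \oo --> F' y) ->
  Ex (fun x => F x * G (T x)) = Ex (fun y => F' y * G y).
Proof.
move=> mF mG F0 G0 FF'; rewrite /expect /Rintegral; congr fine.
(* The density is negative for x < -1/theta; the absolute value changes nothing on the interval and
   gives nonnegativity on the whole line. *)
pose f x := (F x * G (T x) * `|h x|)%:E.
transitivity (\int[mu]_(x in `]0%R, th[) f x)%E.
  apply: eq_integral => x /set_mem/=; rewrite in_itv/= => /andP[x0 _].
  by rewrite /f ger0_norm// ltW// density_gt0// ltW.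
rewrite ge0_integral_branches; first last.
- by move=> x; rewrite lee_fin mulr_ge0// mulr_ge0.
- apply/measurable_EFinP; apply: measurable_funM.
    by apply: measurable_funM => //; exact: (measurableT_comp mG measurable_Ttheta).
  by apply: measurableT_comp => //; exact: measurable_density.
apply: eq_integral => y /set_mem/=; rewrite in_itv/= => /andP[y0 yth].
apply/cvg_lim => //.
have -> : F' y * G y * h y = F' y * (G y * h y) by rewrite mulrA.
have : (fun n => series (fun k => branch_prob (k + m) y * F (branch m (k + m) y)) n * (G y * h y)) @ \oo --> F' y * (G y * h y).
  by apply: cvgMl; apply: FF'; rewrite y0.
move=> FGh.
rewrite (_ : (fun n => _) = EFin \o (fun n => series (fun k => branch_prob (k + m) y * F (branch m (k + m) y)) n * (G y * h y))).
  by apply: cvg_EFin; [exact: nearW|].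
apply/funext => n /=; rewrite /series/= mulr_suml -sumEFin.
apply: eq_bigr => k _; rewrite /f -EFinM; congr EFin.
have l0 : (0 < k + m)%N by rewrite addn_gt0 hm orbT.
rewrite Ttheta_branch//; last by rewrite ltW.
have /andP[b0 _] := branch_bounds (leq_addl k m) (ltW y0).
rewrite ger0_norm ?(ltW (density_gt0 (ltW b0)))//.
transitivity (F (branch m (k + m) y) * G y *
    (h (branch m (k + m) y) * dbranch m (k + m) y)); first by rewrite mulrA.
rewrite density_branch//; last exact: ltW.
ring.
Qed.

End transfer.

(** * Expectation under the invariant probability *)

Section expectation.
Context {R : realType} (m : nat) (hm : (0 < m)%N).
Notation mu := (@lebesgue_measure R).
Local Notation th := (theta m : R).
Local Notation T := (Ttheta m : R -> R).
Local Notation h := (gamma_density m : R -> R).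
Local Notation Ex := (@expect R m).

(** A class stable under sums, products and composition with measurable maps, on which integrability
    is automatic since the density is at most [h 0] on the interval. *)
Definition bdd_meas (F : R -> R) :=
  measurable_fun [set: R] F /\ exists B, forall x, `|F x| <= B.

Lemma bdd_meas_cst k : bdd_meas (fun=> k).
Proof. by split; [exact: measurable_cst|exists `|k|]. Qed.

Lemma bdd_measD F G : bdd_meas F -> bdd_meas G -> bdd_meas (fun x => F x + G x).
Proof.
move=> [mF [B FB]] [mG [C GC]]; split; first exact: measurable_funD.
by exists (B + C) => x; apply: le_trans (ler_normD _ _) _; exact: lerD.
Qed.

Lemma bdd_measM F G : bdd_meas F -> bdd_meas G -> bdd_meas (fun x => F x * G x).
Proof.
move=> [mF [B FB]] [mG [C GC]]; split; first exact: measurable_funM.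
by exists (B * C) => x; rewrite normrM ler_pM.
Qed.

Lemma bdd_measB F G : bdd_meas F -> bdd_meas G -> bdd_meas (fun x => F x - G x).
Proof.
move=> [mF [B FB]] [mG [C GC]]; split; first exact: measurable_funB.
by exists (B + C) => x; apply: le_trans (ler_normB _ _) _; exact: lerD.
Qed.

Lemma bdd_meas_sum (I : Type) (s : seq I) (F : I -> R -> R) :
  (forall i, bdd_meas (F i)) -> bdd_meas (fun x => \sum_(i <- s) F i x).
Proof.
move=> bF; elim: s => [|i s ih].
  by under eq_fun do rewrite big_nil; exact: bdd_meas_cst.
by under eq_fun do rewrite big_cons; exact: bdd_measD.
Qed.

Lemma bdd_meas_comp F g : measurable_fun [set: R] g -> bdd_meas F ->
  bdd_meas (fun x => F (g x)).
Proof.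
move=> mg [mF [B FB]]; split; first exact: (measurableT_comp mF mg).
by exists B => x.
Qed.

Lemma bdd_meas_iter F k : bdd_meas F -> bdd_meas (fun x => F (iter k T x)).
Proof. by apply: bdd_meas_comp; exact: measurable_iter_Ttheta. Qed.

Lemma bdd_meas_homo F d : {homo F : x y / x <= y} -> (forall x, 0 <= F x <= d) ->
  bdd_meas F.
Proof.
move=> mF Fd; split; first exact: nondecreasing_measurable.
by exists d => x; case/andP: (Fd x) => F0 F1; rewrite ger0_norm.
Qed.

Lemma density_le y : 0 <= y -> h y <= h 0.
Proof.
move=> y0; have th0 : 0 < th := theta_gt0 hm.
rewrite /gamma_density ler_wpM2l//.
  by rewrite invr_ge0 ln_ge0// lerDl sqr_ge0.
rewrite mulr0 addr0 ler_pM2l// invr1 invf_le1.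
  by rewrite lerDl mulr_ge0// ltW.
by rewrite ltr_pwDl// mulr_ge0// ltW.
Qed.

Lemma integrable_density F : bdd_meas F ->
  mu.-integrable `]0, th[%classic (EFin \o (fun x => F x * h x)).
Proof.
move=> [mF [B FB]]; apply: measurable_bounded_integrable => //.
- by rewrite /= lebesgue_measure_itv/=; case: ifPn => // _; rewrite -EFinB ltry.
- apply: measurable_funTS; apply: measurable_funM => //.
  exact: measurable_density.
exists (B * h 0); split; first exact: num_real.
move=> M BM x /=; rewrite in_itv/= => /andP[x0 xth].
apply: le_trans (ltW BM); rewrite normrM ler_pM//.
rewrite ger0_norm ?density_le ?ltW//.
exact/density_gt0/ltW.
Qed.

Lemma Ex_eq F G : (forall x, 0 < x < th -> F x = G x) -> Ex F = Ex G.
Proof.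
move=> FG; apply: eq_Rintegral => x /set_mem/=; rewrite in_itv/= => xD.
by rewrite FG.
Qed.

Lemma ExD F G : bdd_meas F -> bdd_meas G -> Ex (fun x => F x + G x) = Ex F + Ex G.
Proof.
move=> bF bG; rewrite /expect -RintegralD//; try exact: integrable_density.
by apply: eq_Rintegral => x _; rewrite mulrDl.
Qed.

Lemma ExB F G : bdd_meas F -> bdd_meas G -> Ex (fun x => F x - G x) = Ex F - Ex G.
Proof.
move=> bF bG; rewrite /expect -RintegralB//; try exact: integrable_density.
by apply: eq_Rintegral => x _; rewrite mulrBl.
Qed.

Lemma ExZ k F : bdd_meas F -> Ex (fun x => k * F x) = k * Ex F.
Proof.
move=> bF; rewrite /expect -RintegralZl//; try exact: integrable_density.
by apply: eq_Rintegral => x _; rewrite mulrA.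
Qed.

Lemma Ex_sum (I : Type) (s : seq I) (F : I -> R -> R) :
  (forall i, bdd_meas (F i)) ->
  Ex (fun x => \sum_(i <- s) F i x) = \sum_(i <- s) Ex (F i).
Proof.
move=> bF; elim: s => [|i s ih].
  rewrite big_nil -[RHS](mul0r (Ex (fun=> 0))) -ExZ; last exact: bdd_meas_cst.
  by apply: Ex_eq => x _; rewrite big_nil mul0r.
rewrite big_cons -ih -ExD//; last exact: bdd_meas_sum.
by apply: Ex_eq => x _; rewrite big_cons.
Qed.

Lemma Ex_le F G : bdd_meas F -> bdd_meas G ->
  (forall x, 0 < x < th -> F x <= G x) -> Ex F <= Ex G.
Proof.
move=> bF bG FG; apply: le_Rintegral => //; try exact: integrable_density.
move=> x /=; rewrite in_itv/= => xD; rewrite ler_wpM2r ?FG//.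
by case/andP: xD => x0 _; apply/ltW/density_gt0/ltW.
Qed.

Lemma Ex_ge0 F : (forall x, 0 < x < th -> 0 <= F x) -> 0 <= Ex F.
Proof.
move=> F0; apply: Rintegral_ge0 => x /=; rewrite in_itv/= => xD.
by rewrite mulr_ge0 ?F0//; case/andP: xD => x0 _; apply/ltW/density_gt0/ltW.
Qed.

Lemma integral_density b : 0 < b ->
  (\int[mu]_(x in `]0%R, b[) (h x)%:E = ((ln (1 + th ^+ 2))^-1 * ln (1 + th * b))%:E)%E.
Proof.
move=> b0; have th0 : 0 < th := theta_gt0 hm.
have mh A : measurable_fun A (fun x => (h x)%:E).
  by apply/measurable_EFinP/measurable_funTS; exact: measurable_density.
rewrite integral_itv_obnd_cbnd// integral_itv_bndo_bndc//.
have pos x : x \in `[0, b]%R -> 0 < 1 + th * x.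
  by rewrite in_itv/= => /andP[x0 _]; rewrite ltr_pwDl// mulr_ge0// ltW.
rewrite (@FTC2_is_derive _ h (fun x => (ln (1 + th ^+ 2))^-1 * ln (1 + th * x)))//.
- by rewrite -EFinB mulr0 addr0 ln1 mulr0 subr0.
- move=> x /pos xp.
  rewrite /gamma_density.
  have -> : (ln (1 + th ^+ 2))^-1 * (th / (1 + th * x)) =
    (ln (1 + th ^+ 2))^-1 *: ((1 + th * x)^-1 * (0 + th *: 1)).
    by rewrite add0r /GRing.scale/= mulr1 [_^-1 * th]mulrC.
  apply: is_deriveZ.
  have h1 := is_derive1_ln xp.
  have h2 : is_derive x 1 (fun x : R => 1 + th * x) (0 + th *: 1) by exact: is_deriveD.
  exact: (@is_derive1_comp _ (@ln R) (fun x => 1 + th * x) x _ _ h1 h2).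
- move=> x /pos xp.
  rewrite /gamma_density; apply: cvgMr; apply: cvgMr.
  apply: cvgV; first exact: lt0r_neq0.
  by apply: cvgD; [exact: cvg_cst|apply: cvgMr; exact: cvg_id].
Qed.

Lemma Ex_cst k : Ex (fun=> k) = k.
Proof.
have th0 : 0 < th := theta_gt0 hm.
rewrite -[k in LHS]mulr1 ExZ; last exact: bdd_meas_cst.
rewrite /expect /Rintegral; under eq_integral do rewrite mul1r.
rewrite integral_density//= -expr2 mulVf ?mulr1// lt0r_neq0//.
by rewrite ln_gt0// ltrDl exprn_gt0.
Qed.

End expectation.

(** * Contraction on monotone functions and exponential decorrelation *)

Section decorrelation.
Context {R : realType} (m : nat) (hm : (0 < m)%N).
Notation mu := (@lebesgue_measure R).
Local Notation th := (theta m : R).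
Local Notation T := (Ttheta m : R -> R).
Local Notation h := (gamma_density m : R -> R).
Local Notation Ex := (@expect R m).
Local Notation p := (@branch_prob R m).
Local Notation v := (@branch R m).

Let th0 : 0 < th. Proof. exact: theta_gt0. Qed.

Let numer_gt0 y : 0 <= y -> 0 < 1 + th * y.
Proof. by move=> y0; rewrite ltr_pwDl// mulr_ge0// ltW. Qed.

(** Closed form of the sum of [branch_prob l y] over l >= t, which telescopes: the conditional
    probability of a digit at least [t]. *)
Definition branch_tail (t : nat) (y : R) : R := (1 + th * y) / (th * (th * t%:R + y)).

Local Notation Q := branch_tail.

Lemma branch_prob_ge0 l y : (0 < l)%N -> 0 <= y -> 0 <= p l y.
Proof.
move=> l0 y0; rewrite divr_ge0//; first by rewrite addr_ge0// mulr_ge0// ltW.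
by rewrite mulr_ge0// ltW// theta_nat_gt0.
Qed.

Lemma branch_tailB l y : (0 < l)%N -> 0 <= y -> p l y = Q l y - Q l.+1 y.
Proof.
move=> l0 y0; rewrite /branch_prob /branch_tail.
have a0 := theta_nat_gt0 hm l0 y0; have b0 := theta_nat_gt0 hm (ltn0Sn l) y0.
move: a0 b0; rewrite -natr1 mulrDr mulr1 => a0 b0.
by field; rewrite !lt0r_neq0.
Qed.

Lemma branch_tail_m y : 0 <= y -> Q m y = 1.
Proof.
move=> y0; rewrite /branch_tail mulrDr mulrA theta_sqrM// divff//.
by rewrite lt0r_neq0// ltr_pwDl// mulr_ge0// ltW.
Qed.

Lemma branch_tail_ge0 t y : (0 < t)%N -> 0 <= y -> 0 <= Q t y.
Proof.
move=> t0 y0; have := theta_nat_gt0 hm t0 y0 => a0.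
by rewrite divr_ge0 ?(ltW (numer_gt0 y0))// mulr_ge0 ?(ltW th0)// ltW.
Qed.

Lemma branch_tail_le n t y : (n < t)%N -> 0 <= y ->
  Q t y <= (1 + th * y) / th / th * harmonic n.
Proof.
move=> nt y0; have t0 : (0 < t)%N by exact: leq_ltn_trans nt.
have a0 := theta_nat_gt0 hm t0 y0.
rewrite /branch_tail /harmonic/= -!mulrA ler_wpM2l ?(ltW (numer_gt0 y0))//.
rewrite (_ : th^-1 * (th^-1 * _) = (th * (th * n.+1%:R))^-1); last by rewrite !invfM.
rewrite lef_pV2 ?posrE ?mulr_gt0//.
rewrite ler_pM2l//; apply: (@le_trans _ _ (th * t%:R)).
  by rewrite ler_pM2l// ler_nat.
by rewrite lerDl.
Qed.

(** After clearing denominators the difference is theta (y - x) (theta^2 t - 1), and theta^2 t >= 1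
    because t >= m. *)
Lemma branch_tail_homo t x y : (m <= t)%N -> 0 <= x -> x <= y -> Q t x <= Q t y.
Proof.
move=> mt x0 xy; have t0 : (0 < t)%N by exact: leq_trans mt.
have y0 := le_trans x0 xy.
have a0 := theta_nat_gt0 hm t0 x0; have b0 := theta_nat_gt0 hm t0 y0.
rewrite /branch_tail ler_pdivrMr ?mulr_gt0// mulrAC ler_pdivlMr ?mulr_gt0//.
have tt : 1 <= th * th * t%:R.
  by rewrite -[leLHS](theta_sqrM hm) ler_wpM2l ?ler_nat// mulr_ge0// ltW.
rewrite -subr_ge0.
have -> : (1 + th * y) * (th * (th * t%:R + x)) - (1 + th * x) * (th * (th * t%:R + y))
  = th * (y - x) * (th * th * t%:R - 1) by ring.
by rewrite mulr_ge0 ?subr_ge0// mulr_ge0 ?subr_ge0// ltW.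
Qed.

Lemma sum_branch_prob n t y : (0 < t)%N -> 0 <= y ->
  \sum_(k < n) p (k + t) y = Q t y - Q (n + t) y.
Proof.
move=> t0 y0; elim: n => [|n ih]; first by rewrite big_ord0 add0n subrr.
by rewrite big_ord_recr/= ih branch_tailB ?addn_gt0 ?t0 ?orbT// addrA subrK addSn.
Qed.

Lemma branch_tail_cvg (s : nat -> nat) y : (forall n, (n < s n)%N) -> 0 <= y ->
  Q (s n) y @[n --> \oo] --> 0.
Proof.
move=> sn y0.
apply: (@squeeze_cvgr _ _ _ _ (fun=> 0) (fun n => (1 + th * y) / th / th * harmonic n)).
- near=> n; rewrite branch_tail_ge0//=; last exact: leq_ltn_trans (sn n).
  exact: branch_tail_le.
- exact: cvg_cst.
- by rewrite -[X in _ --> X](mulr0 ((1 + th * y) / th / th)); apply: cvgMr; exact: cvg_harmonic.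
Unshelve. all: by end_near. Qed.

(** Retraction onto [[0, th]]; composing with it turns monotonicity on the interval into
    monotonicity on the line. *)
Definition clamp (x : R) : R := Num.max 0 (Num.min x th).

Lemma clamp_itv x : 0 <= clamp x <= th.
Proof. by rewrite /clamp le_max lexx/= ge_max (ltW th0)/= ge_min lexx orbT. Qed.

Lemma clamp_homo : {homo clamp : x y / x <= y}.
Proof.
move=> x y xy; rewrite /clamp ge_max le_max lexx/= le_max; apply/orP; right.
by rewrite le_min ge_min xy/= ge_min lexx orbT.
Qed.

Lemma clamp_id x : 0 < x < th -> clamp x = x.
Proof.
by move=> /andP[x0 xth]; rewrite /clamp min_l ?ltW// max_r// ltW.
Qed.

(** Abel summation. The induction needs the stronger [H], which keeps the surplus of the partial
    sums multiplied by the current weight. *)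
Lemma ler_sum_dominated (q1 q2 a : nat -> R) n :
  (forall k, \sum_(i < k) q1 i <= \sum_(i < k) q2 i) ->
  (forall k, 0 <= a k) -> (forall k, a k.+1 <= a k) ->
  \sum_(i < n) q1 i * a i <= \sum_(i < n) q2 i * a i.
Proof.
move=> q12 a0 ad.
suff H : (\sum_(i < n) q2 i - \sum_(i < n) q1 i) * a n <=
    \sum_(i < n) q2 i * a i - \sum_(i < n) q1 i * a i.
  by rewrite -subr_ge0; apply: le_trans H; rewrite mulr_ge0// subr_ge0.
elim: n => [|n ih]; first by rewrite !big_ord0 subrr mul0r.
apply: (@le_trans _ _ ((\sum_(i < n.+1) q2 i - \sum_(i < n.+1) q1 i) * a n)).
  by rewrite ler_wpM2l// subr_ge0.
rewrite !big_ord_recr/=; nra.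
Qed.

(** Transfer operator normalised by the invariant density, so that it fixes constants. *)
Definition branch_op (F : R -> R) (y : R) : R :=
  limn (series (fun k => p (k + m) y * F (v (k + m) y))).

Section monotone.
Variables (F : R -> R) (d : R).
Hypotheses (homoF : {homo F : x y / x <= y}) (Fd : forall x, 0 <= F x <= d).

Let F0 x : 0 <= F x. Proof. by case/andP: (Fd x). Qed.
Let Fled x : F x <= d. Proof. by case/andP: (Fd x). Qed.
Let lm0 k : (0 < k + m)%N. Proof. by rewrite addn_gt0 hm orbT. Qed.

Lemma branch_op_cvg y : 0 <= y ->
  series (fun k => p (k + m) y * F (v (k + m) y)) @ \oo --> branch_op F y.
Proof.
move=> y0.
apply: nondecreasing_is_cvgn.
  apply/nondecreasing_seqP => n; rewrite /series/= !big_mkord big_ord_recr/=.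
  by rewrite lerDl mulr_ge0// branch_prob_ge0.
exists d => _ [n _ <-]; rewrite /series/= big_mkord.
apply: (@le_trans _ _ (\sum_(k < n) p (k + m) y * d)).
  by apply: ler_sum => k _; rewrite ler_wpM2l// branch_prob_ge0.
rewrite -mulr_suml sum_branch_prob// branch_tail_m// ler_piMl ?(le_trans (F0 0))//.
by rewrite gerBl branch_tail_ge0.
Qed.

(** Two effects of the same sign: raising the argument moves every branch point to the left, and
    moves probability towards larger digits, where branch points are smaller. The intermediate sum
    has weights at [y] and points at [z]. *)
Lemma branch_op_anti y z : 0 <= y -> y <= z -> z <= th -> branch_op F z <= branch_op F y.
Proof.
move=> y0 yz zth; have z0 := le_trans y0 yz.
apply: ler_lim; [exact: branch_op_cvg|exact: branch_op_cvg|].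
near=> n; rewrite /series/= !big_mkord.
apply: (@le_trans _ _ (\sum_(k < n) p (k + m) y * F (v (k + m) z))); last first.
  apply: ler_sum => k _; rewrite ler_wpM2l ?branch_prob_ge0// homoF//.
  by rewrite lef_pV2 ?posrE ?theta_nat_gt0// lerD2l.
apply: (@ler_sum_dominated (fun k => p (k + m) z) (fun k => p (k + m) y)
  (fun k => F (v (k + m) z))) => //.
- move=> k; rewrite !sum_branch_prob// !branch_tail_m// lerD2l lerN2.
  by rewrite branch_tail_homo// leq_addl.
- move=> k; apply: homoF; rewrite lef_pV2 ?posrE ?theta_nat_gt0//.
  by rewrite lerD2r ler_pM2l// ler_nat addSn.
Unshelve. all: by end_near. Qed.

(* The right end of each branch is the left end of the next one, so the value
   at 0 is, up to the first term, dominated termwise by the value at theta. *)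
Lemma branch_op_contract : branch_op F 0 <= branch_op F th + d / 2.
Proof.
have d0 : 0 <= d := le_trans (F0 0) (Fled 0).
have c0 := branch_op_cvg (lexx 0).
rewrite -(cvg_lim _ c0)//; apply: limr_le; first by apply/cvg_ex; exists (branch_op F 0).
near=> n; have n0 : (0 < n)%N by near: n; exact: nbhs_infty_gt.
rewrite -(prednK n0); rewrite /series/= big_mkord big_ord_recl/= add0n addrC; apply: lerD.
  apply: (@le_trans _ _ (\sum_(k < n.-1) p (k + m) th * F (v (k + m) th))).
    (* The weights of digit [k + m + 1] at 0 and of digit [k + m] at theta have the same
       denominator, with numerators 1 and 1 + theta^2. *)
    apply: ler_sum => k _; rewrite branch_theta addSn.
    apply: ler_wpM2r => //; rewrite /branch_prob mulr0 !addr0.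
    have -> : th * (k + m)%:R + th = th * (k + m).+1%:R by rewrite -natr1 mulrDr mulr1.
    have -> : th * (k + m).+1%:R + th = th * (k + m).+2%:R by rewrite -[(k + m).+2%:R]natr1 mulrDr mulr1.
    apply: ler_wpM2r; last by rewrite lerDl mulr_ge0// ltW.
    by rewrite invr_ge0 !mulr_ge0// ltW.
  have c1 := branch_op_cvg (ltW th0).
  have nd : nondecreasing_seq (series (fun k => p (k + m) th * F (v (k + m) th))).
    apply/nondecreasing_seqP => k; rewrite /series/= !big_mkord big_ord_recr/=.
    by rewrite lerDl mulr_ge0// branch_prob_ge0// ltW.
  have := nondecreasing_cvgn_le nd (cvgP _ c1) n.-1.
  by rewrite (cvg_lim _ c1)// /series/= big_mkord.
(* The unmatched first term has weight 1/(m+1) <= 1/2: this is the contraction factor. *)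
have pm : p m 0 = m.+1%:R^-1.
  rewrite /branch_prob mulr0 !addr0 mul1r.
  rewrite (_ : _ * _ = th * th * m%:R * m.+1%:R); last by ring.
  by rewrite theta_sqrM// mul1r.
rewrite pm mulrC ler_pM ?invr_ge0//.
by rewrite lef_pV2 ?posrE ?ltr0n// ler_nat.
Unshelve. all: by end_near. Qed.

End monotone.

(** Duality applied to the constant 1, whose image is 1 because the branch probabilities sum to
    1. *)
Lemma expect_invariant (G : R -> R) : measurable_fun [set: R] G -> (forall x, 0 <= G x) ->
  Ex (fun x => G (T x)) = Ex G.
Proof.
move=> mG G0.
have := @Ex_transfer R m hm (fun=> 1) G (fun=> 1) _ mG _ G0.
move=> H; transitivity (Ex (fun x => 1 * G (T x))).
  by apply: Ex_eq => x _; rewrite mul1r.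
rewrite H//; first by apply: Ex_eq => x _; rewrite mul1r.
move=> y /andP[/ltW y0 _].
have -> : series (fun k => p (k + m) y * 1) = fun n => 1 - Q (n + m) y.
  apply/funext => n; rewrite /series/= big_mkord -[X in X - _](branch_tail_m y0).
  by rewrite -sum_branch_prob//; apply: eq_bigr => k _; rewrite mulr1.
rewrite -[X in _ --> X]subr0; apply: cvgB; first exact: cvg_cst.
by apply: branch_tail_cvg => // n; rewrite -addn1 leq_add.
Qed.

Lemma expect_invariant_iter (G : R -> R) k : measurable_fun [set: R] G -> (forall x, 0 <= G x) ->
  Ex (fun x => G (iter k T x)) = Ex G.
Proof.
move=> mG G0; elim: k => [//|k ih]; rewrite -ih.
rewrite -[RHS]expect_invariant//.
  by apply: Ex_eq => x _; rewrite iterSr.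
by apply: (measurableT_comp mG); exact: measurable_iter_Ttheta.
Qed.

(** The image of [F] is nonincreasing. Subtracting it from its value [b] at 0 gives a nondecreasing
    function again, with minimum 0 and half the bound, so the step can be iterated. *)
Lemma homo_step (F : R -> R) d : {homo F : x y / x <= y} -> (forall x, 0 <= F x <= d) ->
  exists b H, [/\ {homo H : x y / x <= y}, forall x, 0 <= H x <= d / 2 &
    forall G, bdd_meas G -> (forall x, 0 <= G x) ->
      Ex (fun x => F x * G (T x)) = b * Ex G - Ex (fun x => H x * G x)].
Proof.
move=> hF Fd; pose b := branch_op F 0; pose H x := b - branch_op F (clamp x).
have hH : {homo H : x y / x <= y}.
  move=> x y xy; rewrite lerD2l lerN2; case/andP: (clamp_itv x) => x0 _.
  case/andP: (clamp_itv y) => _ y1.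
  by apply: branch_op_anti x0 _ y1 => //; exact: clamp_homo.
have Hd x : 0 <= H x <= d / 2.
  case/andP: (clamp_itv x) => x0 x1; apply/andP; split.
    by rewrite /H subr_ge0; exact: (branch_op_anti hF Fd).
  have := branch_op_contract Fd.
  have := branch_op_anti hF Fd x0 x1 (lexx th).
  by rewrite /H /b; lra.
exists b, H; split => // G bG G0.
have bH : bdd_meas H by exact: bdd_meas_homo hH Hd.
rewrite -ExZ// -ExB//; last 2 first.
- by apply: bdd_measM => //; exact: bdd_meas_cst.
- exact: bdd_measM.
rewrite (@Ex_transfer _ _ hm F G (fun x => branch_op F (clamp x)))//.
- by apply: Ex_eq => x _; rewrite /H -mulrBl subKr.
- exact: nondecreasing_measurable.
- by case: bG.
- by move=> x; case/andP: (Fd x).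
- move=> y yth; rewrite clamp_id//.
  by apply: branch_op_cvg (Fd) _ _; case/andP: yth => /ltW.
Qed.

(** In the covariance the constant [b] cancels, leaving up to sign the covariance of [H] at the
    previous lag. The error is relative to the mean of [G], not to its supremum; this keeps errors
    small for indicators of rare events. *)
Lemma homo_decorrelation k (F : R -> R) d G :
  {homo F : x y / x <= y} -> (forall x, 0 <= F x <= d) ->
  bdd_meas G -> (forall x, 0 <= G x) ->
  `|Ex (fun x => F x * G (iter k T x)) - Ex F * Ex G| <= d / 2 ^+ k * Ex G.
Proof.
move=> hF Fd bG G0.
have EG0 : 0 <= Ex G by apply: Ex_ge0.
elim: k F d hF Fd => [|k ih] F d hF Fd.
  rewrite expr0 divr1.
  have bF : bdd_meas F by exact: bdd_meas_homo hF Fd.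
  have F0 x : 0 <= F x by case/andP: (Fd x).
  have F1 x : F x <= d by case/andP: (Fd x).
  have h1 : Ex (fun x => F x * G x) <= d * Ex G.
    rewrite -ExZ//; apply: Ex_le => //; first exact: bdd_measM.
      by apply: bdd_measM => //; exact: bdd_meas_cst.
    by move=> x _; rewrite ler_wpM2r.
  have h2 : 0 <= Ex (fun x => F x * G x) by apply: Ex_ge0 => // x _; rewrite mulr_ge0.
  have h3 : 0 <= Ex F * Ex G by rewrite mulr_ge0//; exact: Ex_ge0.
  have h4 : Ex F * Ex G <= d * Ex G.
    rewrite ler_wpM2r// -[leRHS](Ex_cst hm); apply: Ex_le => //.
    exact: bdd_meas_cst.
  by rewrite /= ler_norml; lra.
have [b [H [hH Hd HE]]] := homo_step hF Fd.
have bH : bdd_meas H by exact: bdd_meas_homo hH Hd.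
have bGk : bdd_meas (fun x => G (iter k T x)) by exact: bdd_meas_iter.
(* The one-step identity tested on the constant 1. *)
have EF : Ex F = b - Ex H.
  have := HE (fun=> 1) (bdd_meas_cst 1) (fun=> ler01).
  rewrite Ex_cst// mulr1.
  rewrite (_ : Ex (fun x => F x * 1) = Ex F); last by apply: Ex_eq => x _; rewrite mulr1.
  by rewrite (_ : Ex (fun x => H x * 1) = Ex H)//; apply: Ex_eq => x _; rewrite mulr1.
have -> : Ex (fun x => F x * G (iter k.+1 T x)) = Ex (fun x => F x * G (iter k T (T x))).
  by apply: Ex_eq => x _; rewrite iterSr.
rewrite (HE (fun x => G (iter k T x)))//.
rewrite expect_invariant_iter//; last by case: bG.
rewrite EF distrC.
have -> : (b - Ex H) * Ex G - (b * Ex G - Ex (fun x => H x * G (iter k T x))) =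
  Ex (fun x => H x * G (iter k T x)) - Ex H * Ex G by ring.
apply: le_trans (ih _ _ hH Hd) _.
by rewrite exprS invfM mulrA.
Qed.

End decorrelation.

(** * Tails and moments of one truncated digit *)

Section moments.
Context {R : realType} (m : nat) (hm : (0 < m)%N).
Notation mu := (@lebesgue_measure R).
Local Notation th := (theta m : R).
Local Notation T := (Ttheta m : R -> R).
Local Notation h := (gamma_density m : R -> R).
Local Notation Ex := (@expect R m).
Local Notation c := (ln (1 + th ^+ 2))^-1.

Let th0 : 0 < th. Proof. exact: theta_gt0. Qed.

Lemma limit_gt0 : 0 < c.
Proof. by rewrite invr_gt0 ln_gt0// ltrDl exprn_gt0. Qed.

Definition digit_ge (t : nat) (x : R) : R :=
  if t%:R <= digit m 0 x then 1 else 0.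

Lemma digit_ge_01 t x : 0 <= digit_ge t x <= 1.
Proof. by rewrite /digit_ge; case: ifP; rewrite ?ler01 lexx. Qed.

Lemma digit_ge_ge0 t x : 0 <= digit_ge t x.
Proof. by case/andP: (digit_ge_01 t x). Qed.

Lemma digit_ge_sqr t x : digit_ge t x * digit_ge t x = digit_ge t x.
Proof. by rewrite /digit_ge; case: ifP; rewrite ?mulr1 ?mulr0. Qed.

Lemma bdd_meas_digit_ge t : bdd_meas (digit_ge t).
Proof.
split; last by exists 1 => x; case/andP: (digit_ge_01 t x) => a0 a1; rewrite ger0_norm.
apply: measurable_fun_ifT; [|exact: measurable_cst|exact: measurable_cst].
by apply: measurable_fun_ler; [exact: measurable_cst|exact: measurable_digit0].
Qed.

Lemma le_digit t x : (t%:R <= digit m 0 x :> R) = (t%:R <= (th * x)^-1).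
Proof. by rewrite /digit/= [t%:R]pmulrn ler_int floor_ge_int. Qed.

Lemma digit_ge_small t x : (t <= m)%N -> 0 < x < th -> digit_ge t x = 1.
Proof.
move=> tm /andP[x0 xth]; rewrite /digit_ge le_digit ifT//.
apply: (@le_trans _ _ m%:R); first by rewrite ler_nat.
rewrite -[leLHS]invrK lef_pV2 ?posrE ?invr_gt0 ?ltr0n ?mulr_gt0//.
rewrite -(ler_pM2r (_ : 0 < m%:R)) ?ltr0n// mulVf ?pnatr_eq0 -?lt0n//.
by rewrite -[leRHS](theta_sqrM hm) ler_wpM2r// ler_wpM2l// ltW.
Qed.

(** Up to null sets the event is x <= 1/(theta t), an endpoint inside the interval since t >= m; the
    density has a logarithmic primitive. *)
Lemma expect_digit_ge t : (m <= t)%N -> Ex (digit_ge t) = c * ln (1 + t%:R^-1).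
Proof.
move=> mt; have t0 : (0 < t)%N by exact: leq_trans mt.
pose b := (th * t%:R)^-1.
have b0 : 0 < b by rewrite invr_gt0 mulr_gt0// ltr0n.
have bth : b <= th.
  rewrite -[leRHS](branch_m0 hm) /branch addr0 lef_pV2 ?posrE ?mulr_gt0 ?ltr0n//.
  by rewrite ler_pM2l// ler_nat.
have mh A : measurable_fun A (fun x => (h x)%:E).
  by apply/measurable_EFinP/measurable_funTS; exact: measurable_density.
have mf A : measurable_fun A (fun x => (digit_ge t x * h x)%:E).
  apply/measurable_EFinP/measurable_funTS; apply: measurable_funM.
    by case: (bdd_meas_digit_ge t).
  exact: measurable_density.
rewrite /expect /Rintegral integral_itv_bndo_bndc//.
transitivity (fine (\int[mu]_(x in `]0%R, th]) ((fun x => (h x)%:E) \_ `]0%R, b]) x))%E.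
  congr fine; apply: eq_integral => x /set_mem/=; rewrite in_itv/= => /andP[x0 xth].
  rewrite patchE /digit_ge le_digit.
  have -> : (t%:R <= (th * x)^-1) = (x \in `]0, b]%classic).
    apply/idP/idP.
      rewrite invf_pge ?posrE ?mulr_gt0 ?ltr0n// => H; rewrite inE/= in_itv/= x0/=.
      by rewrite /b invfM ler_pdivlMl.
    rewrite inE/= in_itv/= x0/= /b invfM ler_pdivlMl// => H.
    by rewrite invf_pge ?posrE ?mulr_gt0 ?ltr0n.
  by case: ifP => _; rewrite ?mul1r ?mul0r.
rewrite -integral_mkcondr.
have -> : `]0, th] `&` `]0, b] = `]0, b]%classic.
  apply/seteqP; split => x /=; rewrite !in_itv/=; first by move=> [].
  by move=> /andP[x0 xb]; rewrite x0 xb (le_trans xb bth).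
rewrite -integral_itv_bndo_bndc// integral_density//=.
by rewrite /b invfM mulrA divff ?lt0r_neq0// mul1r.
Qed.

(** The summand [c] serves t >= m, through ln (1 + 1/t) <= 1/t; the summand [m] serves t < m, where
    the probability is 1 <= m/t. *)
Definition tail_const : R := c + m%:R.
Local Notation K := tail_const.

Lemma tail_const_gt0 : 0 < K.
Proof. by rewrite addr_gt0 ?limit_gt0// ltr0n. Qed.

Lemma expect_digit_ge_le t : (0 < t)%N -> Ex (digit_ge t) <= K / t%:R.
Proof.
move=> t0; have [mt|tm] := leqP m t.
  rewrite expect_digit_ge//.
  apply: (@le_trans _ _ (c * t%:R^-1)).
    have i0 : 0 <= t%:R^-1 :> R by rewrite invr_ge0.
    by rewrite ler_pM2l ?limit_gt0// le_ln1Dx// (lt_le_trans _ i0)// ltrN10.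
  by rewrite ler_wpM2r ?invr_ge0// lerDl.
rewrite (@Ex_eq _ _ _ (fun=> 1)) => [|x xD]; last by rewrite digit_ge_small// ltnW.
rewrite Ex_cst// ler_pdivlMr ?ltr0n// mul1r.
apply: (@le_trans _ _ m%:R); first by rewrite ler_nat ltnW.
by rewrite lerDr ltW// limit_gt0.
Qed.

Local Notation Q := (@branch_tail R m).

Lemma expect_digit_ge_comp t (G : R -> R) : (m <= t)%N ->
  measurable_fun [set: R] G -> (forall x, 0 <= G x) ->
  Ex (fun x => digit_ge t x * G (T x)) = Ex (fun x => Q t (clamp m x) * G x).
Proof.
move=> mt mG G0; have t0 : (0 < t)%N by exact: leq_trans mt.
apply: Ex_transfer => //.
- by case: (bdd_meas_digit_ge t).
- exact: digit_ge_ge0.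
move=> y yth; rewrite clamp_id//; case/andP: yth => /ltW y0 yth.
(* Terms of digit below [t] vanish, so the telescoping starts at [t]; the maximum makes the partial
   sums 0 until then. *)
have -> : series (fun k => branch_prob m (k + m) y * digit_ge t (branch m (k + m) y))
    = fun n => Q t y - Q (maxn t (n + m)) y.
  apply/funext; elim => [|n ih].
    by rewrite /series/= big_geq// add0n (maxn_idPl mt) subrr.
  rewrite seriesSr ih /digit_ge digit_branch ?y0 ?yth// ?addn_gt0 ?hm ?orbT//.
  rewrite ler_nat; case: leqP => tn.
    rewrite mulr1 branch_tailB ?addn_gt0 ?hm ?orbT// addSn.
    by rewrite (maxn_idPr (leqW tn)) addrA subrK.
  by rewrite mulr0 addr0 addSn (maxn_idPl tn).
rewrite -[X in _ --> X]subr0; apply: cvgB; first exact: cvg_cst.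
apply: branch_tail_cvg => // n.
by rewrite leq_max; apply/orP; right; rewrite -addn1 leq_add.
Qed.

(** The indicator itself has oscillation 1. One step, whence the lag [k.+1], replaces it by
    [branch_tail t], whose oscillation (m+1)/(t+1) - m/t is at most 1/t. For t < m the indicator is
    1 on the interval and the covariance vanishes. *)
Lemma digit_ge_decorrelation k t (G : R -> R) : (0 < t)%N ->
  bdd_meas G -> (forall x, 0 <= G x) ->
  `|Ex (fun x => digit_ge t x * G (iter k.+1 T x)) - Ex (digit_ge t) * Ex G|
    <= t%:R^-1 / 2 ^+ k * Ex G.
Proof.
move=> t0 bG G0; have mG := proj1 bG.
have EG0 : 0 <= Ex G by apply: Ex_ge0.
have bGk : bdd_meas (fun x => G (iter k T x)) by exact: bdd_meas_iter.
have [tm|mt] := ltnP t m.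
  have E1 : Ex (digit_ge t) = 1.
    rewrite (@Ex_eq _ _ _ (fun=> 1)) ?Ex_cst// => x xD.
    by rewrite digit_ge_small// ltnW.
  rewrite (@Ex_eq _ _ _ (fun x => G (iter k.+1 T x))) => [|x xD]; last first.
    by rewrite digit_ge_small ?mul1r// ltnW.
  rewrite expect_invariant_iter// E1 mul1r subrr normr0.
  by apply: mulr_ge0 => //; apply: divr_ge0; rewrite ?invr_ge0 ?exprn_ge0.
pose b : R := m%:R / t%:R; pose H x := Q t (clamp m x) - b.
have tp : 0 < t%:R :> R by rewrite ltr0n.
have e : th * th = m%:R^-1.
  by apply: (mulIf (_ : m%:R != 0)); rewrite ?pnatr_eq0 -?lt0n// theta_sqrM// mulVf// pnatr_eq0 -lt0n.
have Q0 : Q t 0 = b.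
  rewrite /branch_tail mulr0 !addr0 mul1r /b mulrA e.
  by field; rewrite !pnatr_eq0 -!lt0n t0 hm.
have hH : {homo H : x y / x <= y}.
  move=> x y xy; rewrite lerD2r branch_tail_homo//; last exact: clamp_homo.
  by case/andP: (clamp_itv hm x).
have Hd x : 0 <= H x <= t%:R^-1.
  case/andP: (clamp_itv hm x) => x0 x1; rewrite subr_ge0 -Q0 branch_tail_homo//=.
  apply: (@le_trans _ _ (Q t th - b)); first by rewrite lerD2r branch_tail_homo.
  have -> : Q t th = (m%:R + 1) / t.+1%:R.
    have q : th * (th * t%:R + th) = th * th * t.+1%:R by rewrite -[t.+1%:R]natr1; ring.
    rewrite /branch_tail q e.
    by field; rewrite [1 + _]addrC natr1 !pnatr_eq0 -!lt0n hm.
  rewrite /b -subr_ge0 -natr1.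
  have -> : t%:R^-1 - ((m%:R + 1) / (t%:R + 1) - m%:R / t%:R) =
     (m%:R + 1) / (t%:R * (t%:R + 1)) :> R.
    by field; rewrite ?[1 + _]addrC ?natr1 !pnatr_eq0 -!lt0n t0.
  by rewrite divr_ge0// ?mulr_ge0// addr_ge0.
have bH : bdd_meas H by exact: bdd_meas_homo hH Hd.
have EE (G' : R -> R) : bdd_meas G' -> (forall x, 0 <= G' x) ->
    Ex (fun x => digit_ge t x * G' (T x)) = Ex (fun x => H x * G' x) + b * Ex G'.
  move=> bG' G'0; rewrite expect_digit_ge_comp//; last by case: bG'.
  rewrite -ExZ// -ExD//.
  - by apply: Ex_eq => x _; rewrite -mulrDl subrK.
  - exact: bdd_measM.
  - by apply: bdd_measM => //; exact: bdd_meas_cst.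
have E1 : Ex (digit_ge t) = Ex H + b.
  have := EE (fun=> 1) (bdd_meas_cst 1) (fun=> ler01).
  rewrite Ex_cst// mulr1.
  rewrite (_ : Ex (fun x => digit_ge t x * 1) = Ex (digit_ge t)); last by apply: Ex_eq => x _; rewrite mulr1.
  by rewrite (_ : Ex (fun x => H x * 1) = Ex H)//; apply: Ex_eq => x _; rewrite mulr1.
have -> : Ex (fun x => digit_ge t x * G (iter k.+1 T x)) =
    Ex (fun x => digit_ge t x * G (iter k T (T x))).
  by apply: Ex_eq => x _; rewrite iterSr.
rewrite (EE (fun x => G (iter k T x)))// expect_invariant_iter// E1.
have -> : Ex (fun x => H x * G (iter k T x)) + b * Ex G - (Ex H + b) * Ex G =
  Ex (fun x => H x * G (iter k T x)) - Ex H * Ex G by ring.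
exact: homo_decorrelation.
Qed.

(* This is min(digit, M); as a sum of indicators of intervals at 0 it inherits
   the decorrelation of monotone functions. *)
Definition trunc_digit (M : nat) (x : R) : R := \sum_(t < M) digit_ge t.+1 x.

Lemma trunc_digitE M (n : nat) x : digit m 0 x = n%:R -> trunc_digit M x = (minn n M)%:R.
Proof.
move=> dx; elim: M => [|M ih]; first by rewrite /trunc_digit big_ord0 minn0.
rewrite /trunc_digit big_ord_recr/= -/(trunc_digit M x) ih /digit_ge dx ler_nat.
have [nM|] := boolP (M < n)%N.
  by rewrite (minn_idPr (ltnW nM)) (minn_idPr nM) natr1.
by rewrite -leqNgt => nM; rewrite addr0 (minn_idPl nM) (minn_idPl (leqW nM)).
Qed.

Lemma trunc_digit_ge0 M x : 0 <= trunc_digit M x.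
Proof. by apply: sumr_ge0 => t _; exact: digit_ge_ge0. Qed.

Lemma trunc_digit_le M x : trunc_digit M x <= M%:R.
Proof.
rewrite -[M in leRHS]card_ord -sumr_const; apply: ler_sum => t _.
by case/andP: (digit_ge_01 t.+1 x).
Qed.

Lemma bdd_meas_trunc_digit M : bdd_meas (trunc_digit M).
Proof. by apply: bdd_meas_sum => t; exact: bdd_meas_digit_ge. Qed.

(** Controls both the mean of [trunc_digit M], up to [K], and its total oscillation after one
    step. *)
Definition harm (M : nat) : R := \sum_(t < M) t.+1%:R^-1.

Lemma harm_ge0 M : 0 <= harm M.
Proof. by apply: sumr_ge0 => t _; rewrite invr_ge0. Qed.

(** A crude (log M)^2 = O(M), enough to absorb oscillation times mean. One step adds 2 [harm M] /
    (M+1) + 1/(M+1)^2 <= 3. *)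
Lemma harm_sqr M : harm M ^+ 2 <= 3 * M%:R.
Proof.
elim: M => [|M ih]; first by rewrite /harm big_ord0 expr0n mulr0.
have hM : harm M <= M%:R.
  rewrite -[M in leRHS]card_ord -sumr_const; apply: ler_sum => t _.
  by rewrite invf_le1 ?ltr0n// ler1n.
rewrite /harm big_ord_recr/= -/(harm M) -[M.+1%:R in leRHS]natr1.
have e : M.+1%:R * M.+1%:R^-1 = 1 :> R by rewrite divff// pnatr_eq0.
have M1 : 1 <= M.+1%:R :> R by rewrite ler1n.
have hM1 : harm M <= M.+1%:R by rewrite -natr1; lra.
have i0 : 0 < M.+1%:R^-1 :> R by rewrite invr_gt0 ltr0n.
have i1 : M.+1%:R^-1 <= 1 :> R by rewrite invf_le1 ?ltr0n.
have : harm M * M.+1%:R^-1 <= 1 by rewrite -[leRHS]e ler_wpM2r// ltW.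
have : M.+1%:R^-1 ^+ 2 <= 1 :> R by rewrite expr_le1// ltW.
rewrite sqrrD; set u := _ ^-1 ^+ 2; set w := harm M * _; lra.
Qed.

Lemma expect_trunc_digit M : Ex (trunc_digit M) = \sum_(t < M) Ex (digit_ge t.+1).
Proof. by rewrite /trunc_digit Ex_sum// => t; exact: bdd_meas_digit_ge. Qed.

Lemma expect_trunc_digit_ge0 M : 0 <= Ex (trunc_digit M).
Proof. by apply: Ex_ge0 => // x _; exact: trunc_digit_ge0. Qed.

Lemma expect_trunc_digit_le M : Ex (trunc_digit M) <= K * harm M.
Proof.
rewrite expect_trunc_digit mulr_sumr; apply: ler_sum => t _.
exact: expect_digit_ge_le.
Qed.

(** From [m] on, the tail probabilities c ln ((t+1)/t) telescope exactly; only the levels up to [m]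
    leave a constant. *)
Lemma expect_trunc_digit_ln M : (m <= M)%N -> Ex (trunc_digit M) =
  Ex (trunc_digit m) - c * ln m.+1%:R + c * ln M.+1%:R.
Proof.
move=> /subnK <-; elim: (M - m)%N => [|n ih]; first by rewrite add0n subrK.
rewrite addSn expect_trunc_digit big_ord_recr/= -expect_trunc_digit ih -addrA.
congr (_ + _); rewrite expect_digit_ge; last by rewrite -addSn leq_addl.
rewrite -mulrDr -lnM ?posrE ?addr_gt0 ?invr_gt0 ?ltr0n//.
by rewrite mulrDr mulr1 divff ?pnatr_eq0// natr1.
Qed.

(** A square is a sum of odd numbers: min(d, M)^2 sums 2t + 1 over t < M with d >= t + 1, and each
    term has mean at most (2t + 1) K / (t + 1) <= 2K. *)
Lemma expect_trunc_digit_sqr M :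
  Ex (fun x => trunc_digit M x * trunc_digit M x) <= 2 * K * M%:R.
Proof.
have bt t : bdd_meas (fun x => (2 * t%:R + 1) * digit_ge t.+1 x).
  by apply: bdd_measM; [exact: bdd_meas_cst|exact: bdd_meas_digit_ge].
apply: (@le_trans _ _ (Ex (fun x => \sum_(t < M) (2 * t%:R + 1) * digit_ge t.+1 x))).
  apply: Ex_le => //.
  - by apply: bdd_measM; exact: bdd_meas_trunc_digit.
  - by apply: bdd_meas_sum => t; exact: bt.
  move=> x _; elim: M => [|M ih]; first by rewrite /trunc_digit !big_ord0 mulr0.
  rewrite /trunc_digit !big_ord_recr/= -/(trunc_digit M x).
  have := digit_ge_sqr M.+1 x; have := digit_ge_ge0 M.+1 x.
  have := trunc_digit_le M x; have := trunc_digit_ge0 M x; nra.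
rewrite (Ex_sum hm); last by move=> t; exact: bt.
rewrite -[M in leRHS]card_ord -sumr_const mulr_sumr; apply: ler_sum => t _.
rewrite (ExZ hm); last exact: bdd_meas_digit_ge.
rewrite mulr1; apply: (@le_trans _ _ ((2 * t%:R + 1) * (K / t.+1%:R))).
  by rewrite ler_wpM2l ?expect_digit_ge_le// addr_ge0// mulr_ge0.
rewrite mulrA ler_pdivrMr ?ltr0n// -natr1.
have := ltW tail_const_gt0; have : 0 <= t%:R :> R by []. nra.
Qed.

Lemma trunc_digit_decorrelation M k (G : R -> R) : bdd_meas G -> (forall x, 0 <= G x) ->
  Ex (fun x => trunc_digit M x * G (iter k.+1 T x)) - Ex (trunc_digit M) * Ex G
    <= harm M / 2 ^+ k * Ex G.
Proof.
move=> bG G0.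
have -> : Ex (fun x => trunc_digit M x * G (iter k.+1 T x)) =
    \sum_(t < M) Ex (fun x => digit_ge t.+1 x * G (iter k.+1 T x)).
  rewrite -Ex_sum//; first by apply: Ex_eq => x _; rewrite mulr_suml.
  move=> t; apply: bdd_measM; first exact: bdd_meas_digit_ge.
  exact: (bdd_meas_iter _ _ bG).
rewrite expect_trunc_digit !mulr_suml -sumrB; apply: ler_sum => t _.
apply: le_trans (digit_ge_decorrelation k (ltn0Sn t) bG G0); exact: ler_norm.
Qed.

End moments.

(** * Variance of truncated sums, pairs of large digits, almost sure convergence *)

Section birkhoff.
Context {R : realType} (m : nat) (hm : (0 < m)%N).
Notation mu := (@lebesgue_measure R).
Local Notation th := (theta m : R).
Local Notation T := (Ttheta m : R -> R).
Local Notation h := (gamma_density m : R -> R).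
Local Notation Ex := (@expect R m).
Local Notation K := (@tail_const R m).
Local Notation f := (@trunc_digit R m).

Definition birkhoff (F : R -> R) (n : nat) (x : R) : R := \sum_(k < n) F (iter k T x).

Lemma birkhoffS F n x : birkhoff F n.+1 x = F x + birkhoff F n (T x).
Proof.
rewrite /birkhoff big_ord_recl/=; congr (_ + _).
by apply: eq_bigr => k _; rewrite -iterSr.
Qed.

Lemma bdd_meas_birkhoff F n : bdd_meas F -> bdd_meas (birkhoff F n).
Proof. by move=> bF; apply: bdd_meas_sum => k; exact: bdd_meas_iter. Qed.

Lemma expect_birkhoff F n : bdd_meas F -> (forall x, 0 <= F x) ->
  Ex (birkhoff F n) = n%:R * Ex F.
Proof.
move=> bF F0; rewrite /birkhoff (Ex_sum hm); last by move=> k; exact: bdd_meas_iter.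
rewrite (eq_bigr (fun=> Ex F)) => [|k _]; last first.
  by apply: expect_invariant_iter => //; case: bF.
by rewrite sumr_const card_ord mulr_natl.
Qed.

Lemma expect_mul_birkhoff F G n : bdd_meas F -> bdd_meas G ->
  Ex (fun x => F x * birkhoff G n (T x)) = \sum_(k < n) Ex (fun x => F x * G (iter k.+1 T x)).
Proof.
move=> bF bG; rewrite -(Ex_sum hm); last first.
  by move=> k; apply: bdd_measM => //; exact: (bdd_meas_iter _ _ bG).
by apply: Ex_eq => x _; rewrite mulr_sumr; apply: eq_bigr => k _; rewrite iterSr.
Qed.

Lemma sum_half n : \sum_(k < n) (2 ^+ k)^-1 <= 2 :> R.
Proof.
suff -> : \sum_(k < n) (2 ^+ k)^-1 = 2 - 2 / 2 ^+ n :> R.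
  by rewrite gerBl divr_ge0// exprn_ge0.
elim: n => [|n ih]; first by rewrite big_ord0 expr0 divr1 subrr.
rewrite big_ord_recr/= ih exprS; field.
by rewrite expf_neq0// pnatr_eq0.
Qed.

(** With [W n] the centred sum, W (n+1) = (f - e) + W n o T, and invariance recovers the variance of
    [W n]. Each step adds the second moment 2KM and twice a cross term of at most 2 [harm M] e <=
    6KM, that is 14KM. *)
Lemma variance_birkhoff M n :
  Ex (fun x => (birkhoff (f M) n x - n%:R * Ex (f M)) ^+ 2) <= 14 * K * (n%:R * M%:R).
Proof.
have bf : bdd_meas (f M) by exact: bdd_meas_trunc_digit.
have f0 := @trunc_digit_ge0 R m M.
have [e eE] : exists e, Ex (f M) = e by exists (Ex (f M)).
rewrite eE; have e0 : 0 <= e by rewrite -eE; exact: expect_trunc_digit_ge0.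
have He : @harm R M * e <= 3 * K * M%:R.
  have K0 : 0 < K := tail_const_gt0 hm.
  have H0 : 0 <= @harm R M by exact: harm_ge0.
  apply: (@le_trans _ _ (K * @harm R M ^+ 2)).
    rewrite expr2 mulrA [leRHS]mulrC ler_wpM2l// -eE; exact: expect_trunc_digit_le.
  by rewrite [3 * K]mulrC -mulrA ler_pM2l// harm_sqr.
pose W n x := birkhoff (f M) n x - n%:R * e.
have bW k : bdd_meas (W k).
  by apply: bdd_measB; [exact: bdd_meas_birkhoff|exact: bdd_meas_cst].
have bWT k : bdd_meas (fun x => W k (T x)).
  by apply: (bdd_meas_comp _ (bW k)); exact: measurable_Ttheta.
have bfe : bdd_meas (fun x => f M x - e).
  by apply: bdd_measB => //; exact: bdd_meas_cst.
have bWW k : bdd_meas (fun x => W k x * W k x) by exact: bdd_measM.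
suff : Ex (fun x => W n x * W n x) <= 14 * K * (n%:R * M%:R).
  by congr (_ <= _); apply: Ex_eq => x _; rewrite expr2.
elim: n => [|n ih].
  rewrite mul0r mulr0 (@Ex_eq _ _ _ (fun=> 0)) ?Ex_cst// => x _.
  by rewrite /W /birkhoff big_ord0 mul0r subr0 mul0r.
have -> : Ex (fun x => W n.+1 x * W n.+1 x) =
  Ex (fun x => (f M x - e) * (f M x - e)) +
  (2 * Ex (fun x => (f M x - e) * W n (T x)) + Ex (fun x => W n x * W n x)).
  rewrite -[X in _ + (_ + X)](@expect_invariant _ _ hm); last 2 first.
  - by case: (bWW n).
  - by move=> x; rewrite -expr2 sqr_ge0.
  rewrite -(ExZ hm); last exact: bdd_measM.
  rewrite -(ExD hm); last 2 first.
  - by apply: bdd_measM; [exact: bdd_meas_cst|exact: bdd_measM].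
  - by apply: (bdd_meas_comp _ (bWW n)); exact: measurable_Ttheta.
  rewrite -(ExD hm); last 2 first.
  - exact: bdd_measM.
  - apply: bdd_measD.
      by apply: bdd_measM; [exact: bdd_meas_cst|exact: bdd_measM].
    by apply: (bdd_meas_comp _ (bWW n)); exact: measurable_Ttheta.
  apply: Ex_eq => x _; rewrite /W birkhoffS -natr1; ring.
have V1 : Ex (fun x => (f M x - e) * (f M x - e)) <= 2 * K * M%:R.
  apply: le_trans (expect_trunc_digit_sqr hm M).
  rewrite (_ : Ex (fun x => (f M x - e) * (f M x - e)) =
      Ex (fun x => f M x * f M x) - (2 * e * Ex (f M) - e * e)).
    by rewrite lerBlDr eE; nra.
  rewrite -(ExZ hm)// -[X in _ - (_ - X)](Ex_cst hm).
  rewrite -(ExB hm); [|by apply: bdd_measM => //; exact: bdd_meas_cst|exact: bdd_meas_cst].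
  rewrite -(ExB hm); [|exact: bdd_measM|].
    by apply: Ex_eq => x _; ring.
  apply: bdd_measB; last exact: bdd_meas_cst.
  by apply: bdd_measM => //; exact: bdd_meas_cst.
have V2 : Ex (fun x => (f M x - e) * W n (T x)) <= 6 * K * M%:R.
  have bfn : bdd_meas (birkhoff (f M) n) by exact: bdd_meas_birkhoff.
  have bfnT : bdd_meas (fun x => birkhoff (f M) n (T x)).
    by apply: (bdd_meas_comp _ bfn); exact: measurable_Ttheta.
  have -> : Ex (fun x => (f M x - e) * W n (T x)) =
      Ex (fun x => f M x * birkhoff (f M) n (T x)) - n%:R * e * e.
    transitivity (Ex (fun x => f M x * birkhoff (f M) n (T x)) -
      (n%:R * e * Ex (f M) + (e * Ex (fun x => birkhoff (f M) n (T x)) - n%:R * e * e))).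
      rewrite -(ExZ hm)// -(ExZ hm)// -[X in _ - (_ + (_ - X))](Ex_cst hm).
      rewrite -(ExB hm); [|by apply: bdd_measM => //; exact: bdd_meas_cst|exact: bdd_meas_cst].
      rewrite -(ExD hm); [|by apply: bdd_measM => //; exact: bdd_meas_cst|].
        rewrite -(ExB hm); [|exact: bdd_measM|].
          by apply: Ex_eq => x _; rewrite /W; ring.
        apply: bdd_measD; first by apply: bdd_measM => //; exact: bdd_meas_cst.
        apply: bdd_measB; last exact: bdd_meas_cst.
        by apply: bdd_measM => //; exact: bdd_meas_cst.
      apply: bdd_measB; last exact: bdd_meas_cst.
      by apply: bdd_measM => //; exact: bdd_meas_cst.
    rewrite expect_invariant//; last 2 first.
    - by case: bfn.
    - by move=> x; apply: sumr_ge0 => k _; exact: f0.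
    by rewrite expect_birkhoff// eE; ring.
  rewrite expect_mul_birkhoff//.
  have -> : n%:R * e * e = \sum_(k < n) (e * e).
    by rewrite sumr_const card_ord -mulrA mulr_natl.
  rewrite -sumrB.
  apply: (@le_trans _ _ (\sum_(k < n) (2 ^+ k)^-1 * (@harm R M * e))).
    apply: ler_sum => k _; rewrite mulrCA mulrA.
    by have := trunc_digit_decorrelation hm M k bf f0; rewrite eE.
  rewrite -mulr_suml; apply: (@le_trans _ _ (2 * (@harm R M * e))).
    by rewrite ler_wpM2r ?sum_half// mulr_ge0// harm_ge0.
  lra.
rewrite -natr1; lra.
Qed.

Lemma birkhoff_digit_ge_nat t n x :
  exists k : nat, birkhoff (@digit_ge R m t) n x = k%:R.
Proof.
exists (\sum_(k < n) (t%:R <= digit m 0 (iter k T x))%R)%N.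
rewrite natr_sum; apply: eq_bigr => k _; rewrite /digit_ge.
by case: ifP.
Qed.

(* If B is the number of digits at least t, then B^2 - B is twice the number of
   pairs of such digits. *)
Lemma expect_two_large t n : (0 < t)%N ->
  Ex (fun x => birkhoff (@digit_ge R m t) n x ^+ 2 - birkhoff (@digit_ge R m t) n x)
    <= n%:R ^+ 2 * ((K + 1) * K / t%:R ^+ 2).
Proof.
move=> t0; pose a := @digit_ge R m t.
have ba : bdd_meas a by exact: bdd_meas_digit_ge.
have a0 x : 0 <= a x by exact: digit_ge_ge0.
have tp : 0 < t%:R :> R by rewrite ltr0n.
have K0 : 0 < K := tail_const_gt0 hm.
pose V n x := birkhoff a n x ^+ 2 - birkhoff a n x.
have bn k : bdd_meas (birkhoff a k) by exact: bdd_meas_birkhoff.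
have bV k : bdd_meas (V k).
  apply: bdd_measB => //; exact: (bdd_measM (bn k) (bn k)).
have V0 k x : 0 <= V k x.
  rewrite /V; have [j ->] := birkhoff_digit_ge_nat t k x.
  by rewrite subr_ge0 -natrX ler_nat; case: j => // j; rewrite -[leqLHS]expn1 leq_pexp2l.
have P0 : 0 <= Ex a by exact: Ex_ge0.
have Pt : Ex a <= K / t%:R by exact: expect_digit_ge_le.
rewrite -/(V n); elim: n => [|n ih].
  rewrite expr0n/= mul0r (@Ex_eq _ _ _ (fun=> 0)) ?Ex_cst// => x _.
  by rewrite /V /birkhoff big_ord0 expr0n subrr.
have bnT : bdd_meas (fun x => birkhoff a n (T x)).
  by apply: (bdd_meas_comp _ (bn n)); exact: measurable_Ttheta.
have -> : Ex (V n.+1) = 2 * Ex (fun x => a x * birkhoff a n (T x)) + Ex (V n).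
  rewrite -[X in _ + X](@expect_invariant _ _ hm)//; last by case: (bV n).
  rewrite -(ExZ hm); last exact: bdd_measM.
  rewrite -(ExD hm); last 2 first.
  - by apply: bdd_measM; [exact: bdd_meas_cst|exact: bdd_measM].
  - by apply: (bdd_meas_comp _ (bV n)); exact: measurable_Ttheta.
  apply: Ex_eq => x _; rewrite /V birkhoffS.
  have := digit_ge_sqr m t x; rewrite -/(a x) => aa.
  rewrite sqrrD expr2 aa; ring.
(* Each pair costs the product of means, at most (K/t)^2, plus a decorrelation error of at most
   (1/t)(K/t). *)
have B : Ex (fun x => a x * birkhoff a n (T x)) <= n%:R * ((K + 1) * K / t%:R ^+ 2).
  rewrite expect_mul_birkhoff//.
  have -> : n%:R * ((K + 1) * K / t%:R ^+ 2) = \sum_(k < n) ((K + 1) * K / t%:R ^+ 2).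
    by rewrite sumr_const card_ord mulr_natl.
  apply: ler_sum => k _.
  have := digit_ge_decorrelation hm k t0 ba a0; rewrite -/a => /ler_normlP[_ H].
  have k1 : t%:R^-1 / 2 ^+ k <= t%:R^-1 :> R.
    rewrite ler_pdivrMr ?exprn_gt0// ler_peMr ?invr_ge0//.
    by rewrite exprn_ege1// ler1n.
  have H2 : t%:R^-1 / 2 ^+ k * Ex a <= t%:R^-1 * (K / t%:R).
    by apply: ler_pM => //; rewrite divr_ge0 ?invr_ge0 ?exprn_ge0.
  have H3 : Ex a * Ex a <= K / t%:R * (K / t%:R) by apply: ler_pM.
  rewrite (_ : (K + 1) * K / t%:R ^+ 2 = K / t%:R * (K / t%:R) + t%:R^-1 * (K / t%:R)).
    lra.
  by field; rewrite lt0r_neq0.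
have c0 : 0 <= (K + 1) * K / t%:R ^+ 2.
  apply: divr_ge0; last by rewrite exprn_ge0// ltW.
  by apply: mulr_ge0; [rewrite addr_ge0// ltW|rewrite ltW].
rewrite -natr1; nra.
Qed.

(** Takes the place of Borel-Cantelli: the series of the [W j] times the density has finite
    integral, so it is finite almost everywhere and its terms tend to 0; the density is positive and
    can be divided out. *)
Lemma expect_summable_cvg0 (W : nat -> R -> R) (a : nat -> R) (A : R) :
  (forall j, bdd_meas (W j)) -> (forall j x, 0 <= W j x) ->
  (forall j, Ex (W j) <= a j) -> (forall n, \sum_(j < n) a j <= A) ->
  exists N : set R, [/\ measurable N, mu N = 0%E &
    forall x, 0 < x < th -> ~ N x -> W j x @[j --> \oo] --> 0].
Proof.
move=> bW W0 Wa aA.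
pose g j x := (W j x * `|h x|)%:E.
have mg j : measurable_fun [set: R] (g j).
  apply/measurable_EFinP; apply: measurable_funM; first by case: (bW j).
  by apply: measurableT_comp => //; exact: measurable_density.
have g0 j x : (0 <= g j x)%E by rewrite lee_fin mulr_ge0.
pose D : set R := `]0, th[%classic.
have mD : measurable D by exact: measurable_itv.
have ig j : (\int[mu]_(x in D) g j x = (Ex (W j))%:E)%E.
  rewrite /expect /Rintegral fineK; last first.
    apply: integrable_fin_num => //; exact: integrable_density.
  apply: eq_integral => x /set_mem; rewrite /D/= in_itv/= => /andP[/ltW x0 _].
  by rewrite /g ger0_norm// ltW// density_gt0.
have ser : (\int[mu]_(x in D) (\sum_(0 <= j <oo) g j x) <= A%:E)%E.
  rewrite integral_nneseries//; last by move=> j; exact: measurable_funS (mg j).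
  apply: lime_le; first by apply: is_cvg_nneseries => j _ _; apply: integral_ge0.
  near=> n; rewrite big_mkord.
  rewrite (eq_bigr (fun j => (Ex (W (val j)))%:E)) => [|j _]; last exact: ig.
  rewrite sumEFin lee_fin; apply: le_trans (aA n); exact: ler_sum.
have ser0 x : (0 <= \sum_(0 <= j <oo) g j x)%E by apply: nneseries_ge0.
have ising : mu.-integrable D (fun x => \sum_(0 <= j <oo) g j x)%E.
  apply/integrableP; split.
    by apply: ge0_emeasurable_sum => //; move=> j _; exact: measurable_funS (mg j).
  under eq_integral do rewrite gee0_abs//.
  by apply: le_lt_trans ser _; rewrite ltry.
have [N [mN N0 subN]] : {ae mu, forall x, D x -> (\sum_(0 <= j <oo) g j x)%E \is a fin_num}.
  exact: integrable_ae.
exists N; split => // x xD nNx.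
have fin : (\sum_(0 <= j <oo) g j x)%E \is a fin_num.
  have := contra_not (@subN x) nNx; rewrite /= => /contrapT; apply.
  by rewrite /D /= in_itv.
have hx : 0 < h x by apply: density_gt0 => //; case/andP: xD => /ltW.
have cs : cvgn (series (fun j => W j x * `|h x|)).
  apply: nondecreasing_is_cvgn.
    apply/nondecreasing_seqP => n; rewrite /series/= !big_mkord big_ord_recr/=.
    by rewrite lerDl mulr_ge0.
  exists (fine (\sum_(0 <= j <oo) g j x)%E) => _ [n _ <-].
  rewrite -lee_fin fineK// /series/= -sumEFin.
  by apply: nneseries_lim_ge => *; exact: g0.
have := cvg_series_cvg_0 cs => c0.
have -> : (fun j => W j x) = (fun j => (W j x * `|h x|) * `|h x|^-1).
  by apply/funext => j; rewrite mulfK// normr_eq0 lt0r_neq0.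
by rewrite -[X in _ --> X](mul0r `|h x|^-1); apply: cvgMl.
Unshelve. all: by end_near. Qed.

End birkhoff.

(** * Block lengths, truncation levels and their asymptotics *)

Section scales.
Context {R : realType}.

(** Taking the seventh root as the unit makes every scale an integer power, so estimates reduce to
    polynomial algebra. *)
Definition root7 (j : nat) : R := j.+1%:R `^ 7%:R^-1.
Local Notation s := root7.

Lemma root7X j : s j ^+ 7 = j.+1%:R.
Proof. by rewrite -powR_mulrn ?powR_ge0// -powRrM mulVf ?powRr1// pnatr_eq0. Qed.

Lemma root7_ge1 j : 1 <= s j.
Proof.
rewrite leNgt; apply/negP => s1.
have : s j ^+ 7 < 1 by rewrite expr_lt1 ?powR_ge0.
by rewrite root7X ltNge ler1n.
Qed.

Lemma root7_gt0 j : 0 < s j.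
Proof. exact: lt_le_trans (root7_ge1 j). Qed.

Lemma root7_le j : s j <= s j.+1.
Proof.
rewrite -(@ler_pXn2r _ 7) ?nnegrE ?(ltW (root7_gt0 _))//.
by rewrite !root7X ler_nat.
Qed.

Lemma root7S j : s j.+1 ^+ 7 = s j ^+ 7 + 1.
Proof. by rewrite !root7X natr1. Qed.

Lemma root7S_le j : s j.+1 <= 2 * s j.
Proof.
have s0 := root7_gt0 j.
rewrite -(@ler_pXn2r _ 7) ?nnegrE ?mulr_ge0 ?(ltW (root7_gt0 _))//.
rewrite exprMn root7S; have : 1 <= s j ^+ 7 by rewrite exprn_ege1// root7_ge1.
have : 2 <= 2 ^+ 7 :> R by rewrite -[leLHS]expr1 ler_eXn2l// ltr1n.
nra.
Qed.

(** Factor b^7 - a^7 = 1 as (b - a) times seven monomials of degree 6, each at least a^6; the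
    companion lower bound uses that each is at most b^6. *)
Lemma root7_diff_ub j : (s j.+1 - s j) * (7 * s j ^+ 6) <= 1.
Proof.
have := root7S j; have := root7_le j; have := root7_gt0 j.
set a := s j; set b := s j.+1 => a0 ab e.
have b0 : 0 < b by exact: lt_le_trans ab.
have e1 : (b - a) * \sum_(i < 7) b ^+ (6 - i) * a ^+ i = 1.
  by rewrite -subrXX e addrAC subrr add0r.
rewrite -[leRHS]e1 ler_wpM2l ?subr_ge0// mulr_natl -[X in _ *+ X](card_ord 7) -sumr_const.
apply: ler_sum => i _.
have -> : a ^+ 6 = a ^+ (6 - i) * a ^+ i by rewrite -exprD subnK// -ltnS.
rewrite ler_wpM2r ?exprn_ge0 ?(ltW a0)//.
by rewrite lerXn2r ?nnegrE ?(ltW a0) ?(ltW b0).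
Qed.

Lemma root7_diff_lb j : 1 <= (s j.+1 - s j) * (7 * s j.+1 ^+ 6).
Proof.
have := root7S j; have := root7_le j; have := root7_gt0 j.
set a := s j; set b := s j.+1 => a0 ab e.
have b0 : 0 < b by exact: lt_le_trans ab.
have e1 : (b - a) * \sum_(i < 7) b ^+ (6 - i) * a ^+ i = 1.
  by rewrite -subrXX e addrAC subrr add0r.
rewrite -[leLHS]e1 ler_wpM2l ?subr_ge0// mulr_natl -[X in _ *+ X](card_ord 7) -sumr_const.
apply: ler_sum => i _.
have -> : b ^+ 6 = b ^+ (6 - i) * b ^+ i by rewrite -exprD subnK// -ltnS.
rewrite ler_wpM2l ?exprn_ge0 ?(ltW b0)//.
by rewrite lerXn2r ?nnegrE ?(ltW a0) ?(ltW b0).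
Qed.

(* Since the seventh powers increase by 1, (s (j+1))^-8 is at most seven times
   the decrease of 1/s. *)
Lemma sum_root7 k : \sum_(j < k) (s j ^+ 8)^-1 <= 8.
Proof.
(* The constant 8 makes the telescoped bound an equality at n = 0, where both sides are 1. *)
suff H n : \sum_(j < n.+1) (s j ^+ 8)^-1 <= 8 - 7 / s n.
  case: k => [|k]; first by rewrite big_ord0.
  by apply: le_trans (H k) _; rewrite gerBl divr_ge0// ltW// root7_gt0.
elim: n => [|n ih].
  have s1 : s 0 = 1 by rewrite /s powR1.
  by rewrite big_ord_recr big_ord0/= s1 expr1n invr1; lra.
rewrite big_ord_recr/=.
have := root7_diff_lb n; have := root7_gt0 n; have := root7_le n.
move: ih; set a := s n; set b := s n.+1 => ih ab a0 D.
have b0 : 0 < b by exact: lt_le_trans ab.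
suff : (b ^+ 8)^-1 <= 7 / a - 7 / b by lra.
have -> : 7 / a - 7 / b = (b - a) * 7 / (a * b) by field; rewrite !lt0r_neq0.
rewrite ler_pdivlMr ?mulr_gt0// mulrC ler_pdivrMr ?exprn_gt0//.
apply: (@le_trans _ _ (b * b)); first by rewrite ler_wpM2r// ltW.
have -> : (b - a) * 7 * b ^+ 8 = (b - a) * (7 * b ^+ 6) * (b * b) by ring.
by rewrite ler_peMl// mulr_ge0// ltW.
Qed.

Lemma root7V_cvg0 : (s j)^-1 @[j --> \oo] --> 0.
Proof.
have c8 : cvgn (series (fun j => (s j ^+ 8)^-1)).
  apply: nondecreasing_is_cvgn.
    apply/nondecreasing_seqP => n; rewrite /series/= !big_mkord big_ord_recr/=.
    by rewrite lerDl invr_ge0 exprn_ge0// ltW// root7_gt0.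
  by exists 8 => _ [n _ <-]; rewrite /series/= big_mkord sum_root7.
have := cvg_series_cvg_0 c8 => h8.
apply/cvgrPdist_lt => e e0.
have e8 : 0 < e ^+ 8 by rewrite exprn_gt0.
move/cvgrPdist_lt : h8 => /(_ _ e8); apply: filterS => j.
by rewrite !sub0r !normrN -exprVn normrX ltr_pXn2r ?nnegrE ?normr_ge0 ?(ltW e0).
Qed.

Lemma squeeze_root7 (x : nat -> R) C l : (forall j, l <= x j <= l + C / s j) ->
  x j @[j --> \oo] --> l.
Proof.
move=> xl; apply: (@squeeze_cvgr _ _ _ _ (fun=> l) (fun j => l + C / s j)).
- by near=> j; exact: xl.
- exact: cvg_cst.
- rewrite -[X in _ --> X]addr0; apply: cvgD; first exact: cvg_cst.
  by rewrite -[X in _ --> X](mulr0 C); apply: cvgMr; exact: root7V_cvg0.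
Unshelve. all: by end_near. Qed.

(* The blocks are n_j ~ exp (s_j^6) and the truncation level is M_j ~ n_j s_j^4:
   both M_j / (n_j (log n_j)^2) and (n_j / M_j)^2 are then O(s_j^-8), which is
   summable, while n_(j+1) / n_j still tends to 1 and M_j = o(n_j log n_j). *)
Definition log_scale (j : nat) : R := s j ^+ 6.
Local Notation u := log_scale.

Definition block (j : nat) : nat := (Num.truncn (expR (u j))).+1.

Definition level_ratio (j : nat) : nat := (Num.truncn (s j ^+ 4)).+1.
Local Notation w := level_ratio.

Lemma log_scale_ge j : s j <= u j.
Proof. by rewrite /u -[leLHS]expr1 ler_weXn2l// root7_ge1. Qed.

Lemma log_scale_gt0 j : 0 < u j.
Proof. exact: lt_le_trans (root7_gt0 j) (log_scale_ge j). Qed.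

(** As b <= 2a, b^6 - a^6 <= 6 (2a)^5 (b - a). Multiplied by a, this is 192/7 times 7 a^6 (b - a) <=
    1, and 192/7 < 28. *)
Lemma log_scaleS j : u j <= u j.+1 <= u j + 28 / s j.
Proof.
have := root7_diff_ub j; have := root7_le j; have := root7_gt0 j; have := root7S_le j.
rewrite /u; set a := s j; set b := s j.+1 => b2 a0 ab D.
have b0 : 0 < b by exact: lt_le_trans ab.
apply/andP; split; first by rewrite lerXn2r ?nnegrE ?(ltW a0) ?(ltW b0).
rewrite -lerBlDl ler_pdivlMr// subrXX.
apply: (@le_trans _ _ ((b - a) * (6 * (2 * a) ^+ 5) * a)).
  rewrite ler_wpM2r ?(ltW a0)// ler_wpM2l ?subr_ge0//.
  rewrite mulr_natl -[X in _ *+ X](card_ord 6) -sumr_const.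
  apply: ler_sum => i _.
  have -> : (2 * a) ^+ 5 = (2 * a) ^+ (5 - i) * (2 * a) ^+ i by rewrite -exprD subnK// -ltnS.
  rewrite ler_pM ?exprn_ge0 ?(ltW a0) ?(ltW b0)//; rewrite lerXn2r ?nnegrE ?mulr_ge0 ?(ltW a0) ?(ltW b0)//.
  by rewrite ler_peMl ?(ltW a0)// ler1n.
have -> : (b - a) * (6 * (2 * a) ^+ 5) * a = (192 / 7) * ((b - a) * (7 * a ^+ 6)) by field.
apply: (@le_trans _ _ (192 / 7 * 1)); first by rewrite ler_wpM2l.
lra.
Qed.

Lemma block_itv j : expR (u j) <= (block j)%:R <= expR (u j) + 1.
Proof.
have /andP[h1 h2] := truncn_itv (ltW (expR_gt0 (u j))).
by rewrite (ltW h2) /block -natr1 lerD2r.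
Qed.

Lemma block_pos j : (0 < block j)%N.
Proof. by []. Qed.

Lemma level_ratio_pos j : (0 < w j)%N.
Proof. by []. Qed.

Lemma block_gt0 j : 0 < (block j)%:R :> R.
Proof. by rewrite ltr0n. Qed.

Lemma block_le j : (block j <= block j.+1)%N.
Proof.
have /andP[h1 _] := log_scaleS j.
by rewrite ltnS le_truncn// ler_expR.
Qed.

Lemma block_unbounded k : exists j, (k < block j)%N.
Proof.
(* At this index the root exceeds [k], since its seventh power is k^7 + 1, and the block exceeds the
   root. *)
exists (k ^ 7)%N; rewrite -(ltr_nat R); have /andP[h1 _] := block_itv (k ^ 7)%N.
apply: lt_le_trans h1; apply: lt_le_trans (expR_ge1Dx _).
rewrite ltr_wpDl//; apply: lt_le_trans (log_scale_ge _).
rewrite -(@ltr_pXn2r _ 7) ?nnegrE ?(ltW (root7_gt0 _))//.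
by rewrite root7X -natrX ltr_nat.
Qed.

(** For the increment d <= 28/s <= 28, 1 - d <= exp (-d) yields exp d <= 1 + d exp d, whence 28 exp
    28; the final 1 pays for rounding, as [s j] <= exp ([u j]). *)
Lemma block_ratio j : (1 : R) <= (block j.+1)%:R / (block j)%:R <= 1 + (28 * expR 28 + 1) / s j.
Proof.
have /andP[b1 b2] := block_itv j; have /andP[b3 b4] := block_itv j.+1.
have /andP[u1 u2] := log_scaleS j.
have s0 := root7_gt0 j; have s1 := root7_ge1 j.
rewrite ler_pdivlMr ?block_gt0// mul1r ler_nat block_le/=.
rewrite ler_pdivrMr ?block_gt0//.
have E0 := expR_gt0 (u j).
set d := u j.+1 - u j.
have d0 : 0 <= d by rewrite subr_ge0.
have ds : d <= 28 / s j by rewrite lerBlDl.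
have d28 : d <= 28.
  by apply: le_trans ds _; rewrite ler_pdivrMr// ler_peMr.
have ed : expR d <= 1 + 28 / s j * expR 28.
  have h1 : 1 - d <= expR (- d) by exact: expR_ge1Dx.
  have h2 : expR d * expR (- d) = 1 by rewrite -expRD subrr expR0.
  have h3 : expR d <= expR 28 by rewrite ler_expR.
  have h4 := expR_gt0 d.
  have h5 : d * expR d <= 28 / s j * expR 28 by apply: ler_pM => //; exact: ltW.
  have : expR d * (1 - d) <= 1 by rewrite -[leRHS]h2 ler_pM2l.
  rewrite mulrBr mulr1 lerBlDr [expR d * d]mulrC => h6.
  by apply: le_trans h6 _; rewrite lerD2l.
have eu : 1 <= expR (u j) / s j.
  rewrite ler_pdivlMr// mul1r; apply: le_trans (log_scale_ge j) _.
  by apply: le_trans (expR_ge1Dx _); rewrite lerDr.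
apply: (le_trans b4).
have -> : expR (u j.+1) = expR (u j) * expR d by rewrite -expRD addrC subrK.
apply: (@le_trans _ _ ((1 + (28 * expR 28 + 1) / s j) * expR (u j))).
  have -> : (1 + (28 * expR 28 + 1) / s j) * expR (u j) =
     expR (u j) * (1 + 28 / s j * expR 28) + expR (u j) / s j.
    by field; rewrite lt0r_neq0.
  by rewrite lerD// ler_wpM2l// ltW.
have p28 : 0 < 28 * expR 28 + 1 :> R.
  by apply: addr_gt0 ltr01; apply: mulr_gt0 (expR_gt0 28); rewrite ltr0n.
by apply: ler_wpM2l b1; apply: addr_ge0 ler01 _; apply: divr_ge0 (ltW p28) (ltW s0).
Qed.

Lemma block_bound :
  exists2 C : R, 0 <= C & forall j, (block j.+1)%:R <= C * (block j)%:R :> R.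
Proof.
have [C HC] : exists C : R, forall j, (1 : R) <= (block j.+1)%:R / (block j)%:R <= 1 + C / s j.
  by exists (28 * expR 28 + 1) => j; exact: block_ratio.
have C0 : 0 <= C.
  have /andP[h1 h2] := HC 0%N; have := le_trans h1 h2.
  by rewrite lerDl pmulr_lge0// invr_gt0 root7_gt0.
exists (1 + C); first exact: addr_ge0.
move=> j; have /andP[_ h] := HC j; rewrite -ler_pdivrMr ?block_gt0//.
by apply: (le_trans h); rewrite lerD2l ler_pdivrMr ?root7_gt0// ler_peMr// root7_ge1.
Qed.

Lemma near_block k : \forall j \near \oo, (k <= block j)%N.
Proof.
have [j0 kj0] := block_unbounded k; exists j0 => // j /= jj.
apply: leq_trans (ltnW kj0) _.
have bh : {homo block : a b / (a <= b)%N}.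
  by apply: homo_leq => //; [exact: leq_trans|exact: block_le].
exact: bh.
Qed.

Lemma ln_block j : u j <= ln (block j)%:R <= u j + 1.
Proof.
have /andP[b1 b2] := block_itv j.
rewrite -[in X in X && _](expRK (u j)) -[in X in _ && X](expRK (u j + 1)).
rewrite !ler_ln ?posrE ?expR_gt0 ?block_gt0// b1/=.
apply: (le_trans b2); rewrite expRD.
have := expR_ge1Dx (1 : R); have : 1 <= expR (u j).
  by rewrite -[leLHS]expR0 ler_expR ltW// log_scale_gt0.
nra.
Qed.

Lemma level_ratio_itv j : s j ^+ 4 <= (w j)%:R <= 2 * s j ^+ 4.
Proof.
have s4 : 1 <= s j ^+ 4 by rewrite exprn_ege1// root7_ge1.
have /andP[h1 h2] := truncn_itv (le_trans ler01 s4).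
rewrite (ltW h2) /w -natr1/=; lra.
Qed.

Lemma log_scaleV j : 1 / u j <= 1 / s j.
Proof. by rewrite !div1r lef_pV2 ?posrE ?root7_gt0 ?log_scale_gt0// log_scale_ge. Qed.

Lemma ln_block_ratio_cvg : ln (block j)%:R / u j @[j --> \oo] --> (1 : R).
Proof.
apply: (@squeeze_root7 _ 1) => j; have /andP[h1 h2] := ln_block j.
have u0 := log_scale_gt0 j.
apply/andP; split; first by rewrite ler_pdivlMr// mul1r.
apply: (@le_trans _ _ (1 + 1 / u j)).
  by rewrite ler_pdivrMr// mulrDl !mul1r mulVf// lt0r_neq0.
by rewrite lerD2l log_scaleV.
Qed.

Lemma log_scale_ratio_cvg : u j.+1 / u j @[j --> \oo] --> (1 : R).
Proof.
apply: (@squeeze_root7 _ 28) => j; have /andP[h1 h2] := log_scaleS j.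
have u0 := log_scale_gt0 j; have s0 := root7_gt0 j.
have u1 : 1 <= u j := le_trans (root7_ge1 j) (log_scale_ge j).
apply/andP; split; first by rewrite ler_pdivlMr// mul1r.
rewrite ler_pdivrMr//; apply: (le_trans h2).
have : 28 / s j <= 28 / s j * u j by rewrite ler_peMr// divr_ge0// ltW.
lra.
Qed.

Lemma block_ratio_cvg : (block j.+1)%:R / (block j)%:R @[j --> \oo] --> (1 : R).
Proof. by apply: squeeze_root7 => j; exact: block_ratio. Qed.

Lemma level_log_le j : (w j)%:R / u j <= 2 / s j.
Proof.
have u0 := log_scale_gt0 j; have s0 := root7_gt0 j; have s1 := root7_ge1 j.
have /andP[_ h] := level_ratio_itv j.
rewrite ler_pdivrMr//; apply: (le_trans h).
have -> : 2 / s j * u j = 2 * s j ^+ 4 * s j by rewrite /u; field; rewrite lt0r_neq0.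
by rewrite ler_peMr// mulr_ge0// exprn_ge0// ltW.
Qed.

Lemma level_log_cvg : (w j)%:R / u j @[j --> \oo] --> (0 : R).
Proof.
apply: (@squeeze_root7 _ 2) => j; rewrite add0r level_log_le andbT.
by rewrite divr_ge0// ltW// log_scale_gt0.
Qed.

(** Even ln (2w) <= 2w suffices, because w <= (2/s) u. The constant 5 is 4 from this and 1 from ln
    (block) <= u + 1. *)
Lemma ln_level_cvg : ln (block j * w j).+1%:R / u j @[j --> \oo] --> (1 : R).
Proof.
apply: (@squeeze_root7 _ 5) => j; have /andP[h1 h2] := ln_block j.
have u0 := log_scale_gt0 j; have s0 := root7_gt0 j.
have w1 : (0 < w j)%N by [].
apply/andP; split.
  rewrite ler_pdivlMr// mul1r; apply: (le_trans h1); rewrite ler_ln ?posrE ?block_gt0 ?ltr0n// ler_nat.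
  by rewrite leqW// leq_pmulr.
rewrite ler_pdivrMr//.
apply: (@le_trans _ _ (ln ((block j)%:R * (2 * (w j)%:R)))).
  have bw : ((block j * w j).+1 <= block j * (2 * w j))%N.
    by rewrite mulnCA mul2n -addnn -addn1 leq_add2l muln_gt0.
  rewrite -natrM -natrM ler_ln ?posrE ?ltr0n ?ler_nat//.
rewrite lnM ?posrE ?block_gt0 ?mulr_gt0 ?ltr0n//.
have l1 : ln (2 * (w j)%:R) <= 2 * (w j)%:R :> R.
  by apply: ltW; apply: ln_sublinear; rewrite mulr_gt0// ltr0n.
have := level_log_le j; rewrite ler_pdivrMr// => l2.
have l3 : 1 <= 1 / s j * u j.
  by rewrite mulrC mulrA mulr1 ler_pdivlMr// mul1r log_scale_ge.
have -> : (1 + 5 / s j) * u j = u j + 2 * (2 / s j * u j) + 1 / s j * u j.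
  by field; rewrite lt0r_neq0.
lra.
Qed.

(** The bounds are uniform within a block, and every large n lies in one. Blocks may be empty, so
    that of n is located as the predecessor of the least [i] with n < [nn i]. *)
Lemma block_squeeze (nn : nat -> nat) (z A B : nat -> R) (c : R) :
  (forall j, nn j <= nn j.+1)%N -> (forall k, exists j, k < nn j)%N ->
  (\forall j \near \oo, forall n, (nn j <= n < nn j.+1)%N -> B j <= z n <= A j) ->
  A j @[j --> \oo] --> c -> B j @[j --> \oo] --> c -> z n @[n --> \oo] --> c.
Proof.
move=> nnS nnoo zAB Ac Bc; apply/cvgrPdist_lt => e e0.
have H : \forall j \near \oo, forall n, (nn j <= n < nn j.+1)%N -> `|c - z n| < e.
  move/cvgrPdist_lt : Ac => /(_ _ e0) Ac; move/cvgrPdist_lt : Bc => /(_ _ e0) Bc.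
  near=> j.
  have hz : forall n, (nn j <= n < nn j.+1)%N -> B j <= z n <= A j by near: j.
  move=> n /hz /andP[].
  have : `|c - A j| < e by near: j.
  have : `|c - B j| < e by near: j.
  rewrite !ltr_norml => /andP[? ?] /andP[? ?] ? ?; apply/andP; split; lra.
case: H => J _ HJ.
exists (nn J) => // n /= Jn.
have [i ni imin] := ex_minnP (nnoo n).
case: i ni imin => [n0 _|i ni imin].
  have nn_homo : {homo nn : a b / (a <= b)%N} by apply: homo_leq => //; exact: leq_trans.
  by have := leq_trans n0 (leq_trans (nn_homo _ _ (leq0n J)) Jn); rewrite ltnn.
have nn_homo : {homo nn : a b / (a <= b)%N} by apply: homo_leq => //; exact: leq_trans.
apply: (HJ i).
  rewrite /= leqNgt; apply/negP => iJ.
  by have := leq_trans ni (leq_trans (nn_homo _ _ iJ) Jn); rewrite ltnn.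
rewrite ni andbT leqNgt; apply/negP => /imin; by rewrite ltnn.
Unshelve. all: by end_near. Qed.

End scales.

(* Otherwise conversion tries to evaluate the truncations. *)
#[local] Opaque block level_ratio root7.

(** * Almost sure limit of the trimmed sums *)

Section main.
Context {R : realType} (m : nat) (hm : (0 < m)%N).
Notation mu := (@lebesgue_measure R).
Local Notation th := (theta m : R).
Local Notation T := (Ttheta m : R -> R).
Local Notation Ex := (@expect R m).
Local Notation c := (ln (1 + th ^+ 2))^-1.
Local Notation K := (@tail_const R m).
Local Notation u := (@log_scale R).
Local Notation block := (@block R).
Local Notation w := (@level_ratio R).
Local Notation s := (@root7 R).

#[local] Hint Resolve block_pos level_ratio_pos : core.

Lemma iter_Ttheta_ge0 k (x : R) : 0 <= x -> 0 <= iter k T x.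
Proof.
move=> x0; case: k => [//|k] /=; have th0 : 0 < th := theta_gt0 hm.
set y := iter k T x; rewrite TthetaE.
have -> : y^-1 = th * (th * y)^-1 by rewrite invfM mulrA divff ?mul1r// lt0r_neq0.
by rewrite -mulrBr mulr_ge0 ?(ltW th0)// subr_ge0 floor_le.
Qed.

Lemma digit_nat k (x : R) : 0 <= x -> exists d : nat, digit m k x = d%:R.
Proof.
move=> x0; rewrite /digit.
have y0 : 0 <= (th * iter k T x)^-1.
  by rewrite invr_ge0 mulr_ge0 ?iter_Ttheta_ge0// ltW// theta_gt0.
exists `|Num.floor (th * iter k T x)^-1|%N.
by rewrite pmulrn gez0_abs// floor_ge0.
Qed.

(** A digit above [M] at a place other than [k0], where the maximum sits, would make two digits
    reach [M]. So all other digits equal their truncation, and the trimmed sum is the truncated sum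
    minus the truncated maximum, a number in [0, M]. *)
Lemma sum_minus_max (M n : nat) (x : R) : 0 <= x ->
  birkhoff m (digit_ge m M) n x <= 1 -> (0 < n)%N ->
  birkhoff m (trunc_digit m M) n x - M%:R <= Ssum m n x - Lmax m n x
    <= birkhoff m (trunc_digit m M) n x.
Proof.
move=> x0; case: n => // n N1 _.
pose d (k : 'I_n.+1) : R := digit m k x.
have d0 k : 0 <= d k by have [j e] := digit_nat k x0; rewrite /d e.
have [k0 k0max] : exists k0, Lmax m n.+1 x = d k0.
  by exists [arg max_(k > ord0) d k]%O; apply: bigmax_eq_arg => // k _; exact: d0.
have dmax k : d k <= d k0 by rewrite -k0max; exact: le_bigmax.
have E : Ssum m n.+1 x - Lmax m n.+1 x =
    birkhoff m (trunc_digit m M) n.+1 x - trunc_digit m M (iter k0 T x).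
  pose S' := \sum_(k < n.+1 | k != k0) digit m k x.
  have e1 : Ssum m n.+1 x = S' + d k0 by rewrite /Ssum (bigD1 k0)//= addrC.
  pose Z' := \sum_(k < n.+1 | k != k0) trunc_digit m M (iter k T x).
  have e2 : birkhoff m (trunc_digit m M) n.+1 x = Z' + trunc_digit m M (iter k0 T x).
    by rewrite /birkhoff (bigD1 k0)//= addrC.
  rewrite k0max e1 e2 !addrK.
  apply: eq_bigr => k kk0; have [j e] := digit_nat k x0.
  rewrite (@trunc_digitE _ _ _ j); last exact: e.
  rewrite e; have [jM|Mj] := leqP j M; first by [].
  have one i : d k <= d i -> digit_ge m M (iter i T x) = 1 :> R.
    move=> ki; rewrite /digit_ge ifT//; apply: le_trans ki.
    by rewrite /d e ler_nat ltnW.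
  move: N1; rewrite /birkhoff (bigD1 k0)//= (bigD1 k)//= !one//.
  rewrite gerDl => h; exfalso.
  have : 0 <= \sum_(i < n.+1 | (i != k0) && (i != k)) digit_ge m M (iter i T x) :> R.
    by apply: sumr_ge0 => i _; exact: digit_ge_ge0.
  move: h; set z := \sum_(_ < _ | _) _; lra.
rewrite E; apply/andP; split; last by rewrite gerBl trunc_digit_ge0.
by rewrite lerD2l lerN2 trunc_digit_le.
Qed.

Local Notation M j := (block j * w j)%N.
Local Notation Z := (birkhoff m (trunc_digit m _)).

Lemma ler_root8 (C a b : R) j : 0 <= C -> s j ^+ 8 * a <= C * b -> 0 < b ->
  a / b <= C * (s j ^+ 8)^-1.
Proof.
move=> C0 h b0; have s8 : 0 < s j ^+ 8 by rewrite exprn_gt0// root7_gt0.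
by rewrite ler_pdivrMr// mulrAC ler_pdivlMr// mulrC.
Qed.

(** The length [nn] is free because the level M_j is used at both ends of block [j]. In [C'], 14K
    comes from the variance and 2 from w <= 2 s^4; the powers of s left over are s^4 / s^12. *)
Lemma deviation_cvg0 (nn : nat -> nat) (C : R) : 0 <= C ->
  (forall j, (nn j)%:R <= C * (block j)%:R) ->
  exists N : set R, [/\ measurable N, mu N = 0%E & forall x, 0 < x < th -> ~ N x ->
    (birkhoff m (trunc_digit m (M j)) (nn j) x -
       (nn j)%:R * Ex (trunc_digit m (M j))) / ((block j)%:R * u j)
      @[j --> \oo] --> 0].
Proof.
move=> C0 nC.
pose D (j : nat) (x : R) := birkhoff m (trunc_digit m (M j)) (nn j) x -
       (nn j)%:R * Ex (trunc_digit m (M j)).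
pose b j : R := (block j)%:R * u j.
have b0 j : 0 < b j by rewrite mulr_gt0 ?block_gt0 ?log_scale_gt0.
have bD j : bdd_meas (D j).
  apply: bdd_measB; last exact: bdd_meas_cst.
  by apply: bdd_meas_birkhoff; exact: bdd_meas_trunc_digit.
have bDD j : bdd_meas (fun x => D j x ^+ 2) by exact: bdd_measM (bD j) (bD j).
pose W (j : nat) (x : R) := (b j ^+ 2)^-1 * D j x ^+ 2.
have K0 : 0 < K := tail_const_gt0 hm.
pose C' : R := 28 * K * C.
have C'0 : 0 <= C' by rewrite mulr_ge0// mulr_ge0// ltW.
have [||j|j|N [mN N0 HN]] := @expect_summable_cvg0 R m hm W
    (fun j => C' * (s j ^+ 8)^-1) (C' * 8).
- by move=> j; apply: bdd_measM => //; exact: bdd_meas_cst.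
- by move=> j x; rewrite mulr_ge0 ?invr_ge0 ?sqr_ge0.
- rewrite (ExZ hm)// mulrC.
  apply: ler_root8 => //; last by rewrite exprn_gt0.
  apply: (@le_trans _ _ (s j ^+ 8 * (14 * K * ((nn j)%:R * (M j)%:R)))).
    by rewrite ler_wpM2l ?exprn_ge0 ?(ltW (root7_gt0 _))// variance_birkhoff.
  have /andP[_ w2] := @level_ratio_itv R j.
  have nj := nC j; have s0 := @root7_gt0 R j; have bj := @block_gt0 R j.
  rewrite natrM.
  apply: (@le_trans _ _ (s j ^+ 8 * (14 * K * ((C * (block j)%:R) *
      ((block j)%:R * (2 * s j ^+ 4)))))).
    rewrite ler_wpM2l ?exprn_ge0 ?(ltW s0)// ler_wpM2l ?mulr_ge0 ?(ltW K0)//.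
    by rewrite ler_pM// ?mulr_ge0// ler_wpM2l.
  by rewrite /b /C' /u le_eqVlt; apply/orP; left; apply/eqP; ring.
- by rewrite -mulr_sumr ler_wpM2l// sum_root7.
exists N; split => // x xth nN.
have := HN x xth nN => /(_ _) h2.
have sq j : W j x = (D j x / b j) ^+ 2 by rewrite expr_div_n mulrC.
apply: norm_cvg0.
have -> : (fun j => `|D j x / b j|) = (fun j => Num.sqrt (W j x)).
  by apply/funext => j; rewrite sq sqrtr_sqr.
rewrite -(@sqrtr0 R); apply: continuous_cvg; first exact: sqrt_continuous.
exact: h2.
Qed.

Lemma birkhoff_le (F : R -> R) k n x : (forall y, 0 <= F y) -> (k <= n)%N ->
  birkhoff m F k x <= birkhoff m F n x.
Proof.
move=> F0 /subnK <-; elim: (n - k)%N => [//|i ih].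
by rewrite addSn /birkhoff big_ord_recr/=; apply: le_trans ih _; rewrite lerDl.
Qed.

(** B^2 - B vanishes for B = 0, 1 and is at least 2 for larger integers, so its convergence to 0
    forces B <= 1 eventually. Counting up to the end of the block covers every n inside. *)
Lemma near_one_large :
  exists N : set R, [/\ measurable N, mu N = 0%E & forall x, 0 < x < th -> ~ N x ->
    \forall j \near \oo, birkhoff m (digit_ge m (M j)) (block j.+1) x <= 1].
Proof.
have [C C0 HC] := @block_bound R.
have K0 : 0 < K := tail_const_gt0 hm.
pose B (j : nat) (x : R) := birkhoff m (digit_ge m (M j)) (block j.+1) x.
pose W (j : nat) (x : R) := B j x ^+ 2 - B j x.
have bB j : bdd_meas (B j) by apply: bdd_meas_birkhoff; exact: bdd_meas_digit_ge.
have W0 j x : 0 <= W j x.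
  rewrite /W /B; have [k ->] := birkhoff_digit_ge_nat m (M j) (block j.+1) x.
  by rewrite subr_ge0 -natrX ler_nat; case: k => // k; rewrite -[leqLHS]expn1 leq_pexp2l.
pose C' : R := C ^+ 2 * ((K + 1) * K).
have C'0 : 0 <= C'.
  by apply: mulr_ge0; [rewrite exprn_ge0|apply: mulr_ge0; [rewrite addr_ge0// ltW|rewrite ltW]].
have Mgt0 j : (0 < M j)%N by rewrite muln_gt0 block_pos level_ratio_pos.
have [||j|j|N [mN N0 HN]] := @expect_summable_cvg0 R m hm W
    (fun j => C' * (s j ^+ 8)^-1) (C' * 8).
- by move=> j; apply: bdd_measB => //; exact: bdd_measM (bB j) (bB j).
- by [].
- apply: le_trans (expect_two_large hm (block j.+1) (Mgt0 j)) _.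
  rewrite mulrA; apply: ler_root8 => //; last by rewrite exprn_gt0// ltr0n.
  have /andP[w1 _] := @level_ratio_itv R j.
  have s0 := @root7_gt0 R j; have bj := @block_gt0 R j.
  have h1 : (block j.+1)%:R ^+ 2 <= (C * (block j)%:R) ^+ 2.
    apply: lerXn2r (HC j); rewrite nnegrE; first exact: ler0n.
    exact: mulr_ge0 C0 (ltW bj).
  have h2 : (s j ^+ 4) ^+ 2 <= (w j)%:R ^+ 2 :> R.
    by rewrite lerXn2r ?nnegrE ?exprn_ge0// ltW.
  have K1 : 0 <= (K + 1) * K by apply: mulr_ge0; [rewrite addr_ge0// ltW|rewrite ltW].
  rewrite natrM exprMn.
  have -> : s j ^+ 8 * ((block j.+1)%:R ^+ 2 * ((K + 1) * K)) =
     ((s j ^+ 4) ^+ 2 * (block j.+1)%:R ^+ 2) * ((K + 1) * K) by ring.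
  apply: (@le_trans _ _ ((w j)%:R ^+ 2 * (C * (block j)%:R) ^+ 2 * ((K + 1) * K))).
    by apply: ler_wpM2r => //; apply: ler_pM => //; rewrite ?exprn_ge0// ltW.
  by rewrite /C' le_eqVlt; apply/orP; left; apply/eqP; ring.
- by rewrite -mulr_sumr ler_wpM2l// sum_root7.
exists N; split => // x xth nN.
have := HN x xth nN => /cvgr_lt /(_ _ ltr01); apply: filterS => j.
rewrite /W /B; have [k ->] := birkhoff_digit_ge_nat m (M j) (block j.+1) x.
case: k => [|[|k]]; rewrite ?ler01//.
rewrite -natrX -natrB ?ltrn1; last by rewrite -[leqLHS]expn1 leq_pexp2l.
by rewrite expnS expn1 mulSn addKn.
Qed.

Lemma expect_level_cvg : Ex (trunc_digit m (M j)) / u j @[j --> \oo] --> c.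
Proof.
pose C0 := Ex (trunc_digit m m) - c * ln m.+1%:R.
have C0u : C0 / u j @[j --> \oo] --> (0 : R).
  rewrite -[X in _ --> X](mulr0 C0); apply: cvgMr.
  apply: (@squeeze_root7 _ _ 1) => j; rewrite add0r invr_ge0 ltW ?log_scale_gt0//=.
  by have := @log_scaleV R j; rewrite div1r.
have L : C0 / u j + c * (ln (M j).+1%:R / u j) @[j --> \oo] --> c.
  rewrite -[X in _ --> X]add0r; apply: cvgD => //.
  by rewrite -[X in _ --> X]mulr1; apply: cvgMr; exact: ln_level_cvg.
apply: cvg_trans L; apply: near_eq_cvg.
near=> j; rewrite (expect_trunc_digit_ln hm); first by rewrite /C0; ring.
apply: (@leq_trans (block j)); last by rewrite leq_pmulr.
by near: j; exact: near_block.
Unshelve. all: by end_near. Qed.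

(** Deterministic part, for a fixed point. For n in block [j], the trimmed sum lies between [X j] -
    M_j and [Y j]; [B] and [A] divide these by the largest and smallest values of n ln n, and both
    tend to [c]. *)
Lemma strong_law (x : R) : 0 < x < th ->
  (birkhoff m (trunc_digit m (M j)) (block j) x -
     (block j)%:R * Ex (trunc_digit m (M j))) / ((block j)%:R * u j) @[j --> \oo] --> 0 ->
  (birkhoff m (trunc_digit m (M j)) (block j.+1) x -
     (block j.+1)%:R * Ex (trunc_digit m (M j))) / ((block j)%:R * u j) @[j --> \oo] --> 0 ->
  (\forall j \near \oo, birkhoff m (digit_ge m (M j)) (block j.+1) x <= 1) ->
  (Ssum m n x - Lmax m n x) / (n%:R * ln n%:R) @[n --> \oo] --> c.
Proof.
move=> /andP[/ltW x0 _] cX cY cN.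
set X := fun j => birkhoff m (trunc_digit m (M j)) (block j) x.
set Y := fun j => birkhoff m (trunc_digit m (M j)) (block j.+1) x.
set e := fun j => Ex (trunc_digit m (M j)).
pose b j : R := (block j)%:R.
pose A j := Y j / (b j * ln (b j)).
pose B j := (X j - (M j)%:R) / (b j.+1 * ln (b j.+1)).
have b0 j : 0 < b j by exact: block_gt0.
have u0 j : 0 < u j by exact: log_scale_gt0.
have l0 j : 0 < ln (b j) by have /andP[h _] := @ln_block R j; exact: lt_le_trans h.
have cA : A j @[j --> \oo] --> c.
  (* Rewrites the bound in terms of quotients whose limits are known: deviation, block ratio, mean
     over [u], logarithm over [u]. *)
  have alg (y p p' q v l : R) : 0 < p -> 0 < v -> 0 < l ->
      y / (p * l) = ((y - p' * q) / (p * v) + p' / p * (q / v)) / (l / v).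
    by move=> p0 v0 q0; field; rewrite !lt0r_neq0.
  have AE : A = fun j => ((Y j - b j.+1 * e j) / (b j * u j) +
      b j.+1 / b j * (e j / u j)) / (ln (b j) / u j).
    by apply/funext => j; exact: alg.
  rewrite AE -[X in _ --> X]divr1; apply: cvgM; last first.
    apply: cvgV; first exact: oner_neq0.
    exact: ln_block_ratio_cvg.
  rewrite -[X in _ --> X]add0r; apply: cvgD; first exact: cY.
  rewrite -[X in _ --> X]mul1r; apply: cvgM; first exact: block_ratio_cvg.
  exact: expect_level_cvg.
have cB : B j @[j --> \oo] --> c.
  have alg (y p p' q v v' r l : R) : 0 < p -> 0 < p' -> 0 < v -> 0 < v' -> 0 < l ->
      (y - p * r) / (p' * l) =
      ((y - p * q) / (p * v) + q / v - r / v) / (p' / p * (l / v' * (v' / v))).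
    by move=> p0 p'0 v0 v'0 l0'; field; rewrite !lt0r_neq0.
  have BE : B = fun j => ((X j - b j * e j) / (b j * u j) + e j / u j - (w j)%:R / u j) /
      (b j.+1 / b j * (ln (b j.+1) / u j.+1 * (u j.+1 / u j))).
    by apply/funext => j; rewrite /B natrM; exact: alg.
  rewrite BE -[X in _ --> X]divr1; apply: cvgM; last first.
    apply: cvgV; first exact: oner_neq0.
    rewrite -[X in _ --> X]mul1r; apply: cvgM; first exact: block_ratio_cvg.
    rewrite -[X in _ --> X]mul1r; apply: cvgM; last exact: log_scale_ratio_cvg.
    rewrite (cvg_shiftS (fun j => ln (b j) / u j)); exact: ln_block_ratio_cvg.
  rewrite -[X in _ --> X]subr0; apply: cvgB; last exact: level_log_cvg.
  rewrite -[X in _ --> X]add0r; apply: cvgD; first exact: cX.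
  exact: expect_level_cvg.
have c0 : 0 < c := limit_gt0 hm.
apply: (block_squeeze (@block_le R) (@block_unbounded R) _ cA cB).
near=> j => n /andP[jn nj].
have N1 : birkhoff m (digit_ge m (M j)) (block j.+1) x <= 1 by near: j.
(* Positivity of the limit makes the numerator [X j] - M_j positive, so enlarging the denominator
   does lower the quotient. *)
have B0 : 0 < B j by near: j; exact: cvgr_gt cB _ c0.
have n0 : (0 < n)%N := leq_trans (@block_pos R j) jn.
have jn' : b j <= n%:R by rewrite ler_nat.
have nj' : n%:R <= b j.+1 by rewrite ler_nat ltnW.
have nR0 : 0 < n%:R :> R by rewrite ltr0n.
have bp i : b i \in Num.pos by rewrite posrE; exact: b0.
have np : (n%:R : R) \in Num.pos by rewrite posrE.
have lnj : ln (b j) <= ln n%:R by rewrite (ler_ln (bp j) np); exact: jn'.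
have lnn : ln n%:R <= ln (b j.+1) by rewrite (ler_ln np (bp j.+1)); exact: nj'.
have ln0 : 0 < ln (n%:R : R) := lt_le_trans (l0 j) lnj.
have /andP[h1 h2] : birkhoff m (trunc_digit m (M j)) n x - (M j)%:R <=
    Ssum m n x - Lmax m n x <= birkhoff m (trunc_digit m (M j)) n x.
  apply: sum_minus_max => //; apply: le_trans N1; apply: birkhoff_le (ltnW nj).
  exact: digit_ge_ge0.
have h3 : X j <= birkhoff m (trunc_digit m (M j)) n x.
  by apply: birkhoff_le => // y; exact: trunc_digit_ge0.
have h4 : birkhoff m (trunc_digit m (M j)) n x <= Y j.
  by apply: birkhoff_le (ltnW nj) => y; exact: trunc_digit_ge0.
have X0 : 0 < X j - (M j)%:R.
  by move: B0; rewrite /B pmulr_lgt0// invr_gt0 mulr_gt0.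
have Y0 : 0 <= Y j by apply: sumr_ge0 => i _; exact: trunc_digit_ge0.
apply/andP; split; rewrite /A /B.
  apply: ler_pM => //; first exact: ltW.
  - by rewrite invr_ge0 mulr_ge0// ltW.
  - by apply: le_trans h1; rewrite lerD2r.
  - by rewrite lef_pV2 ?posrE ?mulr_gt0// ler_pM// ltW.
apply: (@le_trans _ _ (Y j / (n%:R * ln n%:R))).
  rewrite ler_pM2r ?invr_gt0 ?mulr_gt0//; exact: le_trans h2 h4.
apply: (ler_wpM2l Y0).
rewrite lef_pV2 ?posrE; [|exact: mulr_gt0 nR0 ln0|exact: mulr_gt0 (b0 j) (l0 j)].
exact: ler_pM (ltW (b0 j)) (ltW (l0 j)) jn' lnj.
Unshelve. all: by end_near. Qed.

Lemma gamma_theta_null (N : set R) : measurable N -> mu N = 0%E -> gamma_theta m N = 0%E.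
Proof.
move=> mN N0; have mI : measurable (N `&` [set y : R | (0 <= y <= th)%R]).
  apply: measurableI => //.
  rewrite (_ : [set y : R | _] = `[0, th]%classic); first exact: measurable_itv.
  by apply/seteqP; split => y /=; rewrite in_itv.
rewrite /gamma_theta null_set_integral//.
  by apply/measurable_EFinP/measurable_funTS; exact: measurable_density.
by apply: subset_measure0 N0 => // y [].
Qed.

End main.

Theorem theorem1p4 (R : realType) (m : nat) (hm : (0 < m)%N)
  (hsq : ~ exists k : nat, m = (k * k)%N) :
  exists N : set R,
    [/\ measurable N, gamma_theta m N = 0%E &
      forall x : R, 0 <= x <= theta m -> ~ N x ->
        (fun n : nat => (Ssum m n x - Lmax m n x) / (n%:R * ln (n%:R : R)))
          @ \oo --> (ln (1 + theta m ^+ 2 : R))^-1].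
Proof.
have [C C0 HC] := @block_bound R.
have H1 j : (@block R j)%:R <= 1 * (@block R j)%:R :> R by rewrite mul1r.
(* Deviations at the left end of each block, then, with the constant of [block_bound], at the right
   end for the same level. *)
have [N1 [mN1 N10 HN1]] := deviation_cvg0 hm ler01 H1.
have [N2 [mN2 N20 HN2]] := deviation_cvg0 hm C0 HC.
have [N3 [mN3 N30 HN3]] := @near_one_large R m hm.
have m0 : measurable [set (0 : R)] by exact: measurable_set1.
have mth : measurable [set (theta m : R)] by exact: measurable_set1.
have mN : measurable (N1 `|` N2 `|` N3 `|` [set 0] `|` [set (theta m : R)]).
  by do 4 (apply: measurableU => //).
(* The two endpoints join the exceptional set because the preceding results concern the open
   interval. *)
exists (N1 `|` N2 `|` N3 `|` [set 0] `|` [set (theta m : R)]); split => //.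
  apply: gamma_theta_null => //.
  rewrite measureU0//; last 2 first.
  - by do 3 (apply: measurableU => //).
  - exact: lebesgue_measure_set1.
  rewrite measureU0//; last 2 first.
  - by do 2 (apply: measurableU => //).
  - exact: lebesgue_measure_set1.
  by rewrite !measureU0//; exact: measurableU.
move=> x /andP[x0 xth] nN.
have xD : 0 < x < theta m.
  rewrite !lt_neqAle x0 xth !andbT; apply/andP; split; apply/eqP => xE; apply: nN.
    by left; right; rewrite /= -xE.
  by right; rewrite /= xE.
apply: (strong_law hm xD).
- by apply: HN1 => // N1x; apply: nN; do 4 left.
- by apply: HN2 => // N2x; apply: nN; do 3 left; right.
- by apply: HN3 => // N3x; apply: nN; do 2 left; right.
Qed.
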